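(* Using suitable coordinates in the sphere: (a) The elasticae under tension $\sigma$ are the only spherical curves (with $z$ non-constant, up to rotations around the $z$-axis) with spherical angular momentum $\mathcal K(z)=az^2+c$, $a\neq0$, $c\in\mathbb{R}$, with $\sigma=-4ac$. In particular, the free elasticae are characterized by the spherical angular momentum $\mathcal K(z)=az^2$, $a\neq0$. (b) The $\lambda$-elastic curves are the only spherical curves (with $z$ non-constant, up to rotations around the $z$-axis) with spherical angular momentum $\mathcal K(z)=az^2+bz$, $a\neq0$, $b\in\mathbb{R}$, with $\lambda=-b$.
   Context: $\mathbb{S}^2\subset\mathbb{R}^3$ is the unit sphere centred at the origin; a spherical curve is a curve $\xi=(x,y,z)$ in $\mathbb{S}^2$ parametrized by arc length $s$, and a dot denotes the derivative with respect to $s$. The geodesic curvature is $\kappa=\det(\xi,\dot\xi,\ddot\xi)$. The spherical angular momentum of $\xi$ with respect to the $z$-axis is $\mathcal K=-\det(\xi,\dot\xi,\mathbf e)=\dot x\,y-x\,\dot y$ with $\mathbf e=(0,0,1)$; it is considered as a function $\mathcal K(z)$ of the coordinate $z=\langle\xi,\mathbf e\rangle$. ''Suitable coordinates'' means that the coordinates of $\mathbb{R}^3$ are chosen so that the relevant unit vector $\mathbf e$ attached to the elastic curve (for which $\kappa$ is an affine function of $\langle\xi,\mathbf e\rangle$, namely $\kappa=2a\langle\xi,\mathbf e\rangle+b$ with $a\ne0$) is $(0,0,1)$. A spherical curve is an elastica under tension $\sigma\in\mathbb{R}$ if $2\ddot\kappa+\kappa^3+(2-\sigma)\kappa=0$ (critical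 points of $\int_\xi(\kappa^2+\sigma)\,ds$); it is a free elastica if $\sigma=0$. It is a $\lambda$-elastic curve ($\lambda\in\mathbb{R}$) if $2\ddot\kappa+\kappa^3+(2-\lambda^2)\kappa+2\lambda=0$ (critical points of $\int_\xi(\kappa+\lambda)^2\,ds$). *)

(* Defs.v *)
From Stdlib Require Import Reals.
From Coquelicot Require Import Coquelicot.
Open Scope R_scope.

Definition vec3 : Type := (R * R * R)%type.

Definition cx (v : vec3) : R := fst (fst v).
Definition cy (v : vec3) : R := snd (fst v).
Definition cz (v : vec3) : R := snd v.

Definition dot (u v : vec3) : R := cx u * cx v + cy u * cy v + cz u * cz v.

Definition det3 (u v w : vec3) : R :=
  cx u * (cy v * cz w - cz v * cy w)
  - cy u * (cx v * cz w - cz v * cx w)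
  + cz u * (cx v * cy w - cy v * cx w).

Definition e_z : vec3 := (0, 0, 1).

Definition vderive (f : R -> vec3) (s : R) : vec3 :=
  (Derive (fun t => cx (f t)) s,
   Derive (fun t => cy (f t)) s,
   Derive (fun t => cz (f t)) s).

Definition height (xi : R -> vec3) (s : R) : R := dot (xi s) e_z.

(* Curves are total functions on R, but only their values on an open interval
   I are ever used; since I is open, derivatives at points of I depend only on
   the restriction to I. *)
Definition open_interval (I : R -> Prop) : Prop :=
  exists lo hi : Rbar, Rbar_lt lo hi /\
    forall s, I s <-> Rbar_lt lo s /\ Rbar_lt s hi.

Definition smooth_on (I : R -> Prop) (f : R -> vec3) : Prop :=
  forall (n : nat) (s : R), I s ->
    ex_derive_n (fun t => cx (f t)) n s /\
    ex_derive_n (fun t => cy (f t)) n s /\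
    ex_derive_n (fun t => cz (f t)) n s.

Definition nonconstant_on (I : R -> Prop) (f : R -> R) : Prop :=
  exists s t, I s /\ I t /\ f s <> f t.

Definition spherical_curve (I : R -> Prop) (xi : R -> vec3) : Prop :=
  open_interval I /\ smooth_on I xi /\
  forall s, I s ->
    dot (xi s) (xi s) = 1 /\ dot (vderive xi s) (vderive xi s) = 1.

Definition curvature (xi : R -> vec3) (s : R) : R :=
  det3 (xi s) (vderive xi s) (vderive (vderive xi) s).

Definition momentum (xi : R -> vec3) (s : R) : R :=
  - det3 (xi s) (vderive xi s) e_z.

Definition elastica (I : R -> Prop) (xi : R -> vec3) (sigma : R) : Prop :=
  forall s, I s ->
    2 * Derive_n (curvature xi) 2 s + curvature xi s ^ 3
    + (2 - sigma) * curvature xi s = 0.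

Definition free_elastica (I : R -> Prop) (xi : R -> vec3) : Prop :=
  elastica I xi 0.

Definition lambda_elastic (I : R -> Prop) (xi : R -> vec3) (lambda : R) : Prop :=
  forall s, I s ->
    2 * Derive_n (curvature xi) 2 s + curvature xi s ^ 3
    + (2 - lambda ^ 2) * curvature xi s + 2 * lambda = 0.

Definition suitable_coordinates (I : R -> Prop) (xi : R -> vec3) (a : R) : Prop :=
  a <> 0 /\
  exists b, forall s, I s -> curvature xi s = 2 * a * height xi s + b.

(* "The angular momentum is K(z)", for a curve with non-constant z. *)
Definition curve_with_momentum (I : R -> Prop) (xi : R -> vec3) (K : R -> R) : Prop :=
  spherical_curve I xi /\ nonconstant_on I (height xi) /\
  forall s, I s -> momentum xi s = K (height xi s).

(* The rows of a rotation are the new positively oriented coordinate axes. *)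
Definition rotation (A : vec3 * vec3 * vec3) : Prop :=
  let '(u, v, w) := A in
  dot u u = 1 /\ dot v v = 1 /\ dot w w = 1 /\
  dot u v = 0 /\ dot v w = 0 /\ dot u w = 0 /\ det3 u v w = 1.

Definition rotate (A : vec3 * vec3 * vec3) (xi : R -> vec3) (s : R) : vec3 :=
  let '(u, v, w) := A in (dot u (xi s), dot v (xi s), dot w (xi s)).

Definition rot_z (theta : R) (v : vec3) : vec3 :=
  (cos theta * cx v - sin theta * cy v,
   sin theta * cx v + cos theta * cy v,
   cz v).

(* Uniqueness, up to rotations about the z-axis, of the curves with angular
   momentum K(z).  On the unit sphere z'^2 = 1 - z^2 - K(z)^2, so K(z) fixes
   the height only up to its starting point on this phase curve, and the
   phase curve may be disconnected: if K is even, the mirror image of a curve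
   in the plane z = 0 has the same K, although a curve lying in z > 0 is not
   carried to its mirror image by a rotation about the z-axis.  Hence curves
   are compared after a shift of the arc length that matches (z, z'); for
   curves defined on all of R a common height is enough. *)
Definition unique_up_to_z_rotations (K : R -> R) : Prop :=
  (forall (I1 I2 : R -> Prop) (xi1 xi2 : R -> vec3) (t1 t2 : R),
     curve_with_momentum I1 xi1 K -> curve_with_momentum I2 xi2 K ->
     I1 t1 -> I2 t2 ->
     height xi1 t1 = height xi2 t2 ->
     Derive (height xi1) t1 = Derive (height xi2) t2 ->
     exists theta, forall s, I1 (t1 + s) -> I2 (t2 + s) ->
       xi2 (t2 + s) = rot_z theta (xi1 (t1 + s))) /\
  (forall (xi1 xi2 : R -> vec3) (t1 t2 : R),
     curve_with_momentum (fun _ => True) xi1 K ->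
     curve_with_momentum (fun _ => True) xi2 K ->
     height xi1 t1 = height xi2 t2 ->
     exists theta tau, forall s, xi2 s = rot_z theta (xi1 (s + tau))).

(* Main.v *)
Require Import Defs.
From Stdlib Require Import Reals Psatz.
From Coquelicot Require Import Coquelicot.
Open Scope R_scope.

(** Let N = xi x xi', so that the frame (xi, xi', N) solves the Frenet system with
    coefficient k = curvature, and the angular momentum K is minus the height of N.

    Both Euler-Lagrange equations have the form 2 k'' + k^3 + (2 - 2 C) k - 2 b = 0.
    Along a solution the vector V = (k - b) xi + k' xi' + (C - k^2 / 2) N is constant;
    with the z-axis along V, k = 2 a z + b where 2 a = |V|.  Since K' = k z', the relation
    k = 2 a z + b is equivalent to K = a z^2 + b z + c, and substituting
    z'' = - z - k K in the equation of k yields b^2 - 4 a c = 2 C.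

    Uniqueness: the height rows (z, z', -K) solve an autonomous system, so they agree once
    they agree at a point (Gronwall); the frames then solve the same linear system.  If
    the curves are complete and the initial values of z' are opposite, the height is
    reflected about a turning point.  One exists: otherwise z would be monotone, and its
    limits at both ends would be double roots of 1 - z^2 - (a z^2 + b z + c)^2, making this
    quartic <= 0. *)

(** * Calculus on intervals: monotonicity, constancy, a Gronwall estimate *)

Definition convex_pred (J : R -> Prop) : Prop :=
  forall x y z, J x -> J y -> x <= z <= y -> J z.

Lemma open_interval_convex (I : R -> Prop) : Defs.open_interval I -> convex_pred I.
Proof.
  intros [lo [hi [_ H]]] x y z Hx Hy [Hxz Hzy].
  apply H in Hx; apply H in Hy; apply H; split.
  - apply Rbar_lt_le_trans with x; [apply Hx | exact Hxz].
  - apply Rbar_le_lt_trans with y; [exact Hzy | apply Hy].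
Qed.

Lemma open_interval_locally (I : R -> Prop) (s : R) :
  Defs.open_interval I -> I s -> locally s I.
Proof.
  intros [lo [hi [_ H]]] Hs. apply H in Hs.
  generalize (open_Rbar_gt' s lo (proj1 Hs)) (open_Rbar_lt' s hi (proj2 Hs)).
  intros H1 H2.
  generalize (filter_and _ _ H1 H2).
  apply filter_imp. intros y Hy. apply H. exact Hy.
Qed.

Lemma is_derive_loc_eq (I : R -> Prop) (f g : R -> R) (s l : R) :
  Defs.open_interval I -> I s -> (forall t, I t -> f t = g t) ->
  is_derive f s l -> is_derive g s l.
Proof.
  intros HI Hs Hfg. apply is_derive_ext_loc.
  generalize (open_interval_locally I s HI Hs). apply filter_imp. exact Hfg.
Qed.

Lemma is_derive_const_on (I : R -> Prop) (f : R -> R) (c s l : R) :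
  Defs.open_interval I -> I s -> (forall t, I t -> f t = c) ->
  is_derive f s l -> l = 0.
Proof.
  intros HI Hs Hf Hl.
  apply (is_derive_loc_eq I f (fun _ => c) s l HI Hs Hf) in Hl.
  rewrite <- (is_derive_unique _ _ _ Hl). apply Derive_const.
Qed.

Lemma decreasing_on_convex (J : R -> Prop) (f df : R -> R) :
  convex_pred J -> (forall s, J s -> is_derive f s (df s) /\ df s <= 0) ->
  forall x y, J x -> J y -> x <= y -> f y <= f x.
Proof.
  intros HJ Hf x y Hx Hy Hxy.
  destruct (MVT_gen f x y df) as [c [Hc Heq]].
  - rewrite Rmin_left, Rmax_right by lra. intros t Ht.
    apply Hf, (HJ x y); auto; lra.
  - rewrite Rmin_left, Rmax_right by lra. intros t Ht.
    apply derivable_continuous_pt, ex_derive_Reals_0.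
    exists (df t). apply Hf, (HJ x y); auto.
  - rewrite Rmin_left, Rmax_right in Hc by lra.
    assert (df c <= 0) by (apply Hf, (HJ x y); auto). nra.
Qed.

Lemma constant_on_convex (J : R -> Prop) (f : R -> R) :
  convex_pred J -> (forall s, J s -> is_derive f s 0) ->
  forall x y, J x -> J y -> f x = f y.
Proof.
  intros HJ Hf.
  assert (Hle : forall x y, x <= y -> J x -> J y -> f x = f y).
  { intros x y Hxy Hx Hy. apply Rle_antisym.
    - apply Ropp_le_cancel.
      apply (decreasing_on_convex J (fun t => - f t) (fun _ => 0)); auto.
      intros s Hs. split; [ | lra]. rewrite <- Ropp_0.
      apply (@is_derive_opp R_AbsRing R_NormedModule), Hf, Hs.
    - apply (decreasing_on_convex J f (fun _ => 0)); auto.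
      intros s Hs. split; [auto | lra]. }
  intros x y Hx Hy. destruct (Rle_dec x y).
  - now apply Hle.
  - symmetry. apply Hle; auto; lra.
Qed.

(** To the right of [x0] the function [E s * exp (- M * s)] is nonincreasing; to the left,
    [E s * exp (M * s)] is nondecreasing. Both vanish at [x0], so [E <= 0] on each side, while
    [E >= 0] by assumption. *)
Lemma gronwall_zero (J : R -> Prop) (E dE : R -> R) (M x0 : R) :
  convex_pred J -> J x0 ->
  (forall s, J s -> is_derive E s (dE s) /\ Rabs (dE s) <= M * E s /\ 0 <= E s) ->
  E x0 = 0 -> forall s, J s -> E s = 0.
Proof.
  intros HJ H0 HE HE0 s Hs.
  assert (Hbound : forall t, J t -> - (M * E t) <= dE t <= M * E t).
  { intros t Ht. apply Rabs_le_between, HE, Ht. }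
  destruct (HE s Hs) as [_ [_ Hpos]].
  destruct (Rle_dec x0 s) as [Hle | Hgt].
  - assert (Hdec : E s * exp (- M * s) <= E x0 * exp (- M * x0)).
    { apply (decreasing_on_convex J (fun t => E t * exp (- M * t))
               (fun t => (dE t - M * E t) * exp (- M * t))); auto.
      intros t Ht. split.
      - destruct (HE t Ht) as [Hd _].
        evar_last.
        + apply (@is_derive_mult R_AbsRing E (fun t => exp (- M * t)) t
            (dE t) (- M * exp (- M * t)));
            [exact Hd | auto_derive; [trivial | ring] | intros; apply Rmult_comm].
        + unfold plus, mult; simpl. ring.
      - generalize (Hbound t Ht) (exp_pos (- M * t)). nra. }
    rewrite HE0 in Hdec. generalize (exp_pos (- M * s)). nra.
  - assert (Hdec : - (E x0 * exp (M * x0)) <= - (E s * exp (M * s))).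
    { apply (decreasing_on_convex J (fun t => - (E t * exp (M * t)))
               (fun t => - ((dE t + M * E t) * exp (M * t)))); auto; [ | lra].
      intros t Ht. split.
      - destruct (HE t Ht) as [Hd _].
        evar_last.
        + apply (@is_derive_opp R_AbsRing R_NormedModule (fun t => E t * exp (M * t))).
          apply (@is_derive_mult R_AbsRing E (fun t => exp (M * t)) t (dE t) (M * exp (M * t)));
            [exact Hd | auto_derive; [trivial | ring] | intros; apply Rmult_comm].
        + unfold opp, plus, mult; simpl. ring.
      - generalize (Hbound t Ht) (exp_pos (M * t)). nra. }
    rewrite HE0 in Hdec. generalize (exp_pos (M * s)). nra.
Qed.

(** * Rows of Frenet frames *)

(** The Frenet system on the sphere read along one fixed direction: [u], [p], [n] are the components
    of position, tangent and normal. Working row by row lets scalar lemmas serve the height as well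
    as the other two coordinates. *)
Definition frenet_row (J : R -> Prop) (k u p n : R -> R) : Prop :=
  forall s, J s ->
    is_derive u s (p s) /\ is_derive p s (- u s + k s * n s) /\
    is_derive n s (- k s * p s).

Lemma is_derive_sum_squares (u p n : R -> R) (s du dp dn : R) :
  is_derive u s du -> is_derive p s dp -> is_derive n s dn ->
  is_derive (fun t => u t ^ 2 + p t ^ 2 + n t ^ 2) s
    (2 * (u s * du + p s * dp + n s * dn)).
Proof.
  intros Hu Hp Hn. auto_derive.
  - repeat split; eexists; eassumption.
  - change (Derive (fun x => u x) s) with (Derive u s).
    change (Derive (fun x => p x) s) with (Derive p s).
    change (Derive (fun x => n x) s) with (Derive n s).
    rewrite (is_derive_unique _ _ _ Hu), (is_derive_unique _ _ _ Hp),
      (is_derive_unique _ _ _ Hn). ring.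
Qed.

(** The coefficient matrix of the system is antisymmetric. *)
Lemma frenet_row_norm (J : R -> Prop) (k u p n : R -> R) :
  convex_pred J -> frenet_row J k u p n ->
  forall x y, J x -> J y ->
    u x ^ 2 + p x ^ 2 + n x ^ 2 = u y ^ 2 + p y ^ 2 + n y ^ 2.
Proof.
  intros HJ H.
  apply (constant_on_convex J (fun t => u t ^ 2 + p t ^ 2 + n t ^ 2)); auto.
  intros s Hs. destruct (H s Hs) as [Hu [Hp Hn]].
  evar_last.
  - apply is_derive_sum_squares; eassumption.
  - simpl. ring.
Qed.

(** Gronwall applied to the squared distance of the two rows. In its derivative the terms carrying
    [k2] cancel by antisymmetry, and what remains contains the factor
    [k2 - k1 = 2 * a * (u2 - u1)]. *)
Lemma frenet_row_affine_unique (J : R -> Prop) (a b x0 : R)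
    (k1 u1 p1 n1 k2 u2 p2 n2 : R -> R) :
  convex_pred J -> J x0 ->
  frenet_row J k1 u1 p1 n1 -> frenet_row J k2 u2 p2 n2 ->
  (forall s, J s -> k1 s = 2 * a * u1 s + b /\ k2 s = 2 * a * u2 s + b) ->
  u1 x0 ^ 2 + p1 x0 ^ 2 + n1 x0 ^ 2 = 1 ->
  u1 x0 = u2 x0 -> p1 x0 = p2 x0 -> n1 x0 = n2 x0 ->
  forall s, J s -> u1 s = u2 s /\ p1 s = p2 s.
Proof.
  intros HJ H0 H1 H2 Hk Hnorm Hu Hp Hn s Hs.
  assert (HE : (u2 s - u1 s) ^ 2 + (p2 s - p1 s) ^ 2 + (n2 s - n1 s) ^ 2 = 0).
  { apply (gronwall_zero J
      (fun t => (u2 t - u1 t) ^ 2 + (p2 t - p1 t) ^ 2 + (n2 t - n1 t) ^ 2)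
      (fun t => 4 * a * (u2 t - u1 t) *
         ((p2 t - p1 t) * n1 t - (n2 t - n1 t) * p1 t)) (4 * Rabs a) x0); auto;
      [ | rewrite Hu, Hp, Hn; ring].
    intros t Ht. destruct (H1 t Ht) as [A1 [B1 C1]].
    destruct (H2 t Ht) as [A2 [B2 C2]]. destruct (Hk t Ht) as [K1 K2].
    split; [ | split].
    - evar_last.
      + apply (is_derive_sum_squares (fun t => u2 t - u1 t) (fun t => p2 t - p1 t)
                 (fun t => n2 t - n1 t) t);
          apply (@is_derive_minus R_AbsRing R_NormedModule); eassumption.
      + unfold minus, plus, opp; simpl. rewrite K1, K2. ring.
    - assert (N1 : u1 t ^ 2 + p1 t ^ 2 + n1 t ^ 2 = 1).
      { rewrite <- Hnorm. now apply (frenet_row_norm J k1). }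
      rewrite Rmult_assoc, Rabs_mult, (Rabs_mult 4), (Rabs_right 4) by lra.
      apply Rmult_le_compat_l; [generalize (Rabs_pos a); lra | ].
      set (d := u2 t - u1 t). set (e := p2 t - p1 t). set (f := n2 t - n1 t).
      (* Cauchy-Schwarz through Lagrange's identity, with [p1 ^ 2 + n1 ^ 2 = 1 - u1 ^ 2 <= 1]. *)
      assert (Q : (e * n1 t - f * p1 t) ^ 2 <= e ^ 2 + f ^ 2).
      { assert ((e * n1 t - f * p1 t) ^ 2 + (e * p1 t + f * n1 t) ^ 2
                = (e ^ 2 + f ^ 2) * (1 - u1 t ^ 2)) by (rewrite <- N1; ring).
        generalize (pow2_ge_0 (e * p1 t + f * n1 t)) (pow2_ge_0 (e * u1 t))
          (pow2_ge_0 (f * u1 t)). nra. }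
      set (g := e * n1 t - f * p1 t) in *.
      apply Rabs_le. generalize (pow2_ge_0 (d - g)) (pow2_ge_0 (d + g))
         (pow2_ge_0 d) (pow2_ge_0 e) (pow2_ge_0 f). nra.
    - generalize (pow2_ge_0 (u2 t - u1 t)) (pow2_ge_0 (p2 t - p1 t))
        (pow2_ge_0 (n2 t - n1 t)). lra. }
  generalize (pow2_ge_0 (u2 s - u1 s)) (pow2_ge_0 (p2 s - p1 s))
        (pow2_ge_0 (n2 s - n1 s)). split; nra.
Qed.

(** The system is reversible: reversing the parameter changes only the sign of the tangential
    component. With [m = 0] this exchanges the two ends of the line; with [m] twice a turning point
    it is the reflection about that point. *)
Lemma frenet_row_reflect (J : R -> Prop) (m : R) (k u p n : R -> R) :
  frenet_row J k u p n ->
  frenet_row (fun s => J (m - s)) (fun s => k (m - s))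
    (fun s => u (m - s)) (fun s => - p (m - s)) (fun s => n (m - s)).
Proof.
  intros H s Hs. destruct (H _ Hs) as [Hu [Hp Hn]].
  assert (Hm : is_derive (fun s => m - s) s (-1)) by (auto_derive; [trivial | ring]).
  split; [ | split].
  - evar_last. apply (is_derive_comp u (fun s => m - s)); eassumption.
    unfold scal; simpl; unfold mult; simpl. ring.
  - evar_last. apply (@is_derive_opp R_AbsRing R_NormedModule (fun s => p (m - s))).
    apply (is_derive_comp p (fun s => m - s)); eassumption.
    unfold opp, scal; simpl; unfold mult; simpl. ring.
  - evar_last. apply (is_derive_comp n (fun s => m - s)); eassumption.
    unfold scal; simpl; unfold mult; simpl. ring.
Qed.

Lemma frenet_row_shift (J : R -> Prop) (m : R) (k u p n : R -> R) :
  frenet_row J k u p n ->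
  frenet_row (fun s => J (m + s)) (fun s => k (m + s))
    (fun s => u (m + s)) (fun s => p (m + s)) (fun s => n (m + s)).
Proof.
  intros H s Hs. destruct (H _ Hs) as [Hu [Hp Hn]].
  assert (Hm : is_derive (fun s => m + s) s 1) by (auto_derive; [trivial | ring]).
  split; [ | split]; evar_last.
  - apply (is_derive_comp u (fun s => m + s)); eassumption.
  - unfold scal; simpl; unfold mult; simpl. ring.
  - apply (is_derive_comp p (fun s => m + s)); eassumption.
  - unfold scal; simpl; unfold mult; simpl. ring.
  - apply (is_derive_comp n (fun s => m + s)); eassumption.
  - unfold scal; simpl; unfold mult; simpl. ring.
Qed.

(** For a prescribed [k] the system is linear. This serves to form the difference between a
    coordinate of one curve and a rotated coordinate of another. *)
Lemma frenet_row_lin_comb (J : R -> Prop) (a b c : R)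
    (k u1 p1 n1 u2 p2 n2 u3 p3 n3 : R -> R) :
  frenet_row J k u1 p1 n1 -> frenet_row J k u2 p2 n2 -> frenet_row J k u3 p3 n3 ->
  frenet_row J k (fun s => a * u1 s + b * u2 s + c * u3 s)
    (fun s => a * p1 s + b * p2 s + c * p3 s)
    (fun s => a * n1 s + b * n2 s + c * n3 s).
Proof.
  assert (L : forall (f g h : R -> R) (s df dg dh : R),
    is_derive f s df -> is_derive g s dg -> is_derive h s dh ->
    is_derive (fun s => a * f s + b * g s + c * h s) s (a * df + b * dg + c * dh)).
  { intros f g h s df dg dh Hf Hg Hh.
    apply (@is_derive_plus R_AbsRing R_NormedModule (fun s => a * f s + b * g s));
      [apply (@is_derive_plus R_AbsRing R_NormedModule (fun s => a * f s)) | ];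
      now apply is_derive_scal. }
  intros H1 H2 H3 s Hs.
  destruct (H1 s Hs) as [A1 [B1 C1]]. destruct (H2 s Hs) as [A2 [B2 C2]].
  destruct (H3 s Hs) as [A3 [B3 C3]].
  split; [ | split].
  - now apply L.
  - evar_last. apply L; eassumption. ring.
  - evar_last. apply L; eassumption. ring.
Qed.

(** * Limits and turning points of rows defined on the whole line *)

Lemma bounded_derive_limit (f df : R -> R) (B l : R) :
  (forall s, is_derive f s (df s)) -> (forall s, Rabs (f s) <= B) ->
  is_lim df p_infty l -> l = 0.
Proof.
  assert (Hpos : forall (f df : R -> R) (l : R),
    (forall s, is_derive f s (df s)) -> (forall s, Rabs (f s) <= B) ->
    is_lim df p_infty l -> l <= 0).
  { clear f df l. intros f df l Hf HB Hl. destruct (Rle_dec l 0) as [ | Hn]; [assumption | exfalso].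
    apply is_lim_spec in Hl.
    assert (Hl2 : 0 < l / 2) by lra.
    destruct (Hl (mkposreal _ Hl2)) as [M HM]. simpl in HM.
    (* Beyond [M] the slope exceeds [l / 2], so over a time [T] the function gains at least
       [2 * B + 1], more than the width [2 * B] of the band that contains it. *)
    set (T := (2 * B + 1) / (l / 2)).
    assert (HT : T * (l / 2) = 2 * B + 1) by (unfold T; field; lra).
    assert (0 <= B) by (generalize (HB 0) (Rabs_pos (f 0)); lra).
    assert (0 <= T) by nra.
    assert (Hdec : - f (M + 1 + T) + (M + 1 + T) * (l / 2) <= - f (M + 1) + (M + 1) * (l / 2)).
    { apply (decreasing_on_convex (fun s => M < s) (fun s => - f s + s * (l / 2))
               (fun s => - df s + l / 2)); try lra.
      - intros x y z Hx Hy Hz. lra.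
      - intros s Hs. split.
        + apply (@is_derive_plus R_AbsRing R_NormedModule (fun s => - f s)).
          * apply (@is_derive_opp R_AbsRing R_NormedModule), Hf.
          * auto_derive; [trivial | ring].
        + generalize (HM s Hs). intros Q. apply Rabs_lt_between in Q. lra. }
    generalize (proj1 (Rabs_le_between _ _) (HB (M + 1)))
      (proj1 (Rabs_le_between _ _) (HB (M + 1 + T))). nra. }
  intros Hf HB Hl. apply Rle_antisym.
  - now apply (Hpos f df).
  - enough (- l <= 0) by lra.
    apply (Hpos (fun s => - f s) (fun s => - df s)).
    + intros s. apply (@is_derive_opp R_AbsRing R_NormedModule), Hf.
    + intros s. rewrite Rabs_Ropp. apply HB.
    + apply (is_lim_opp df p_infty l Hl).
Qed.

Lemma increasing_bounded_limit (f : R -> R) (B : R) :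
  (forall x y, x <= y -> f x <= f y) -> (forall x, f x <= B) ->
  exists l : R, is_lim f p_infty l /\ forall x, f x <= l.
Proof.
  intros Hf HB.
  destruct (completeness (fun y => exists x, y = f x)) as [l [Hub Hlub]].
  - exists B. intros y [x ->]. apply HB.
  - now exists (f 0), 0.
  - assert (Hl : forall x, f x <= l) by (intros x; apply Hub; now exists x).
    exists l. split; [ | exact Hl].
    apply is_lim_spec. intros [eps Heps]. simpl.
    destruct (Classical_Prop.classic (exists x, l - eps < f x)) as [[x Hx] | Hno].
    + exists x. intros y Hy. generalize (Hf x y) (Hl y). intros.
      apply Rabs_lt_between. lra.
    + exfalso. assert (l <= l - eps); [ | lra].
      apply Hlub. intros y [x ->]. apply Rnot_lt_le. intros Q. apply Hno. now exists x.
Qed.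

Section CompleteRow.

Variables (a b c : R) (k u p n : R -> R).
Hypothesis Hrow : frenet_row (fun _ => True) k u p n.
Hypothesis Hnorm : forall s, u s ^ 2 + p s ^ 2 + n s ^ 2 = 1.
Hypothesis Hk : forall s, k s = 2 * a * u s + b.
Hypothesis Hn : forall s, n s = - (a * u s ^ 2 + b * u s + c).

(** With [P z = 1 - z ^ 2 - (a * z ^ 2 + b * z + c) ^ 2], the two equations are [P l = 0] and
    [P' l / 2 = 0]. Along the row [p ^ 2 = P u] and [p' = P' u / 2]; the bounded functions [p] and
    [u * p] have derivatives converging to [P' l / 2] and [P l + l * P' l / 2], so both limits
    vanish. *)
Lemma frenet_row_limit (l : R) :
  is_lim u p_infty l ->
  1 - l ^ 2 - (a * l ^ 2 + b * l + c) ^ 2 = 0 /\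
  - l - (2 * a * l + b) * (a * l ^ 2 + b * l + c) = 0.
Proof.
  intros Hl.
  assert (Hcont : forall P : R -> R, ex_derive P l ->
    is_lim (fun s => P (u s)) p_infty (P l)).
  { intros P HP. apply (filterlim_comp _ _ _ u P _ (locally l) _ Hl).
    apply (@ex_derive_continuous R_AbsRing R_NormedModule), HP. }
  assert (Hsq : forall s, Rabs (u s) <= 1 /\ Rabs (p s) <= 1).
  { intros s. generalize (Hnorm s) (pow2_ge_0 (u s)) (pow2_ge_0 (p s)) (pow2_ge_0 (n s)).
    intros. split; apply Rabs_le; nra. }
  assert (HQ : - l - (2 * a * l + b) * (a * l ^ 2 + b * l + c) = 0).
  { apply (bounded_derive_limit p
      (fun s => - u s - (2 * a * u s + b) * (a * u s ^ 2 + b * u s + c)) 1).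
    - intros s. destruct (Hrow s Logic.I) as [_ [Hp _]]. evar_last. exact Hp.
      rewrite Hk, Hn. ring.
    - intros s. apply Hsq.
    - apply (Hcont (fun z => - z - (2 * a * z + b) * (a * z ^ 2 + b * z + c))).
      auto_derive. trivial. }
  split; [ | exact HQ].
  enough (1 - l ^ 2 - (a * l ^ 2 + b * l + c) ^ 2
    + l * (- l - (2 * a * l + b) * (a * l ^ 2 + b * l + c)) = 0) by (rewrite HQ in H; lra).
  apply (bounded_derive_limit (fun s => u s * p s)
    (fun s => 1 - u s ^ 2 - (a * u s ^ 2 + b * u s + c) ^ 2
       + u s * (- u s - (2 * a * u s + b) * (a * u s ^ 2 + b * u s + c))) 1).
  - intros s. destruct (Hrow s Logic.I) as [Hu [Hp _]]. evar_last.
    apply (@is_derive_mult R_AbsRing u p s _ _ Hu Hp). intros; apply Rmult_comm.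
    unfold plus, mult; simpl. generalize (Hnorm s). rewrite Hk, Hn. intros E.
    replace (p s * p s) with (1 - u s ^ 2 - (- (a * u s ^ 2 + b * u s + c)) ^ 2) by lra.
    ring.
  - intros s. rewrite Rabs_mult. rewrite <- (Rmult_1_l 1).
    apply Rmult_le_compat; try apply Rabs_pos; apply Hsq.
  - apply (Hcont (fun z => 1 - z ^ 2 - (a * z ^ 2 + b * z + c) ^ 2
      + z * (- z - (2 * a * z + b) * (a * z ^ 2 + b * z + c)))).
    auto_derive. trivial.
Qed.

End CompleteRow.

Lemma frenet_row_not_increasing (a b c : R) (k u p n : R -> R) :
  a <> 0 -> frenet_row (fun _ => True) k u p n ->
  (forall s, u s ^ 2 + p s ^ 2 + n s ^ 2 = 1) ->
  (forall s, k s = 2 * a * u s + b) ->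
  (forall s, n s = - (a * u s ^ 2 + b * u s + c)) ->
  ~ (forall s, 0 < p s).
Proof.
  intros Ha Hrow Hnorm Hk Hn Hp.
  assert (Hinc : forall x y, x <= y -> u x <= u y).
  { intros x y Hxy. apply Ropp_le_cancel.
    apply (decreasing_on_convex (fun _ => True) (fun s => - u s) (fun s => - p s)); auto.
    - now intros ? ? ? ? ? ?.
    - intros s _. split; [ | generalize (Hp s); lra].
      apply (@is_derive_opp R_AbsRing R_NormedModule), (Hrow s Logic.I). }
  assert (Hu : forall s, -1 <= u s <= 1).
  { intros s. generalize (Hnorm s) (pow2_ge_0 (p s)) (pow2_ge_0 (n s)). nra. }
  destruct (increasing_bounded_limit u 1) as [be [Hbe Hbe']]; auto.
  { intros s. apply Hu. }
  (* The limit of [u] at minus infinity is handled by reversing the parameter; because of the sign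
     that keeps the function increasing, this limit is [- al]. *)
  destruct (increasing_bounded_limit (fun s => - u (0 - s)) 1) as [al [Hal Hal']].
  { intros x y Hxy. apply Ropp_le_contravar, Hinc. lra. }
  { intros s. generalize (Hu (0 - s)). lra. }
  destruct (frenet_row_limit a b c k u p n Hrow Hnorm Hk Hn be Hbe) as [Pb Qb].
  destruct (frenet_row_limit a b c (fun s => k (0 - s)) (fun s => u (0 - s))
    (fun s => - p (0 - s)) (fun s => n (0 - s))) with (l := - al) as [Pa Qa]; auto.
  { apply (frenet_row_reflect (fun _ => True) 0 k u p n Hrow). }
  { intros s. rewrite <- (Hnorm (0 - s)). ring. }
  { apply is_lim_ext with (fun s => - - u (0 - s)); [intros; ring | ].
    apply (is_lim_opp _ _ _ Hal). }
  set (z := u 0) in *.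
  assert (Haz : - al <= z).
  { generalize (Hal' 0). rewrite Rminus_0_r. fold z. lra. }
  assert (Hzb : z <= be) by apply Hbe'.
  (* The quartic at [z = u 0] equals [p 0 ^ 2]. This makes [z] differ from both limits and
     contradicts the factorization below. *)
  assert (HP : 0 < 1 - z ^ 2 - (a * z ^ 2 + b * z + c) ^ 2).
  { generalize (Hnorm 0) (Hp 0). rewrite Hn. fold z. nra. }
  remember (- al) as ga.
  assert (Hab : ga < be).
  { destruct (Rle_lt_or_eq_dec ga be) as [ | E]; [lra | assumption | ].
    exfalso. assert (z = be) by lra. subst z. rewrite H in HP. lra. }
  (* Hermite interpolation at the double roots [ga] and [be]:
     1 - z^2 - (a z^2 + b z + c)^2 = - a^2 (z - ga)^2 (z - be)^2 *)
  assert (HH : (be - ga) ^ 3 * (1 - z ^ 2 - (a * z ^ 2 + b * z + c) ^ 2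
             + a ^ 2 * (z - ga) ^ 2 * (z - be) ^ 2) = 0).
  { transitivity
      ((1 - ga ^ 2 - (a * ga ^ 2 + b * ga + c) ^ 2)
         * (be - ga + 2 * (z - ga)) * (be - z) ^ 2
       + 2 * (- ga - (2 * a * ga + b) * (a * ga ^ 2 + b * ga + c))
         * (be - ga) * (z - ga) * (be - z) ^ 2
       + (1 - be ^ 2 - (a * be ^ 2 + b * be + c) ^ 2)
         * (be - ga + 2 * (be - z)) * (z - ga) ^ 2
       - 2 * (- be - (2 * a * be + b) * (a * be ^ 2 + b * be + c))
         * (be - ga) * (be - z) * (z - ga) ^ 2).
    - ring.
    - rewrite Pa, Qa, Pb, Qb. ring. }
  apply Rmult_integral in HH. destruct HH as [HH | HH].
  - generalize (pow_lt (be - ga) 3). lra.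
  - generalize (pow2_ge_0 (a * (z - ga) * (z - be))). nra.
Qed.

(** Without a zero, [p] has a constant sign by the intermediate value theorem; the negative case
    becomes the positive one by reversing the parameter. *)
Lemma frenet_row_turning_point (a b c : R) (k u p n : R -> R) :
  a <> 0 -> frenet_row (fun _ => True) k u p n ->
  (forall s, u s ^ 2 + p s ^ 2 + n s ^ 2 = 1) ->
  (forall s, k s = 2 * a * u s + b) ->
  (forall s, n s = - (a * u s ^ 2 + b * u s + c)) ->
  exists t, p t = 0.
Proof.
  intros Ha Hrow Hnorm Hk Hn.
  destruct (Classical_Prop.classic (exists t, p t = 0)) as [ | Hno]; [assumption | exfalso].
  assert (Hcont : forall x, continuity_pt p x).
  { intros x. apply derivable_continuous_pt, ex_derive_Reals_0.
    eexists. exact (proj1 (proj2 (Hrow x Logic.I))). }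
  assert (Hsign : forall x y, 0 < p x -> 0 < p y).
  { intros x y Hx. apply Rnot_le_lt. intros Hy. apply Hno.
    destruct (IVT_gen p x y 0) as [t [_ Ht]].
    - intros z. apply Hcont.
    - rewrite Rmin_right, Rmax_left by lra. lra.
    - now exists t. }
  destruct (Rlt_dec 0 (p 0)) as [H0 | H0].
  - apply (frenet_row_not_increasing a b c k u p n); auto.
    intros s. now apply (Hsign 0).
  - apply (frenet_row_not_increasing a b c (fun s => k (0 - s)) (fun s => u (0 - s))
             (fun s => - p (0 - s)) (fun s => n (0 - s))); auto.
    + apply (frenet_row_reflect (fun _ => True) 0 k u p n Hrow).
    + intros s. rewrite <- (Hnorm (0 - s)). ring.
    + intros s. assert (~ 0 < p (0 - s)) by (intros H; apply H0, (Hsign _ 0 H)).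
      assert (p (0 - s) <> 0) by (intros H1; apply Hno; now exists (0 - s)). lra.
Qed.

(** * The Frenet frame of a spherical curve *)

(** Unlike the total function [vderive], this relation also asserts that the coordinates are
    differentiable. *)
Definition vec_derive (f : R -> vec3) (s : R) (v : vec3) : Prop :=
  is_derive (fun t => cx (f t)) s (cx v) /\ is_derive (fun t => cy (f t)) s (cy v) /\
  is_derive (fun t => cz (f t)) s (cz v).

Lemma vec_derive_unique (f : R -> vec3) (s : R) (v : vec3) :
  vec_derive f s v -> vderive f s = v.
Proof.
  destruct v as [[v1 v2] v3]. intros [Hx [Hy Hz]]. unfold vderive.
  f_equal; [f_equal | ]; now apply is_derive_unique.
Qed.

Lemma is_derive_prod (f g : R -> R) (s df dg : R) :
  is_derive f s df -> is_derive g s dg ->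
  is_derive (fun t => f t * g t) s (df * g s + f s * dg).
Proof.
  intros Hf Hg. apply (@is_derive_mult R_AbsRing f g s df dg Hf Hg).
  intros; apply Rmult_comm.
Qed.

Lemma vec_derive_dot (f g : R -> vec3) (s : R) (df dg : vec3) :
  vec_derive f s df -> vec_derive g s dg ->
  is_derive (fun t => dot (f t) (g t)) s (dot df (g s) + dot (f s) dg).
Proof.
  intros [Fx [Fy Fz]] [Gx [Gy Gz]]. evar_last.
  - apply (@is_derive_plus R_AbsRing R_NormedModule
      (fun t => cx (f t) * cx (g t) + cy (f t) * cy (g t)));
      [apply (@is_derive_plus R_AbsRing R_NormedModule (fun t => cx (f t) * cx (g t))) | ];
      apply is_derive_prod; eassumption.
  - unfold plus, dot; simpl. ring.
Qed.

Definition cross (u v : vec3) : vec3 :=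
  (cy u * cz v - cz u * cy v, cz u * cx v - cx u * cz v, cx u * cy v - cy u * cx v).

Lemma det3_cross (u v w : vec3) : det3 u v w = dot (cross u v) w.
Proof. unfold det3, dot, cross, cx, cy, cz; simpl. ring. Qed.

Lemma vec_derive_cross (f g : R -> vec3) (s : R) (df dg : vec3) :
  vec_derive f s df -> vec_derive g s dg ->
  vec_derive (fun t => cross (f t) (g t)) s
    (cx (cross df (g s)) + cx (cross (f s) dg),
     cy (cross df (g s)) + cy (cross (f s) dg),
     cz (cross df (g s)) + cz (cross (f s) dg)).
Proof.
  intros [Fx [Fy Fz]] [Gx [Gy Gz]]. split; [ | split]; evar_last.
  - apply (@is_derive_minus R_AbsRing R_NormedModule (fun t => cy (f t) * cz (g t)));
      apply is_derive_prod; eassumption.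
  - unfold minus, plus, opp, cross, cx, cy, cz; simpl. ring.
  - apply (@is_derive_minus R_AbsRing R_NormedModule (fun t => cz (f t) * cx (g t)));
      apply is_derive_prod; eassumption.
  - unfold minus, plus, opp, cross, cx, cy, cz; simpl. ring.
  - apply (@is_derive_minus R_AbsRing R_NormedModule (fun t => cx (f t) * cy (g t)));
      apply is_derive_prod; eassumption.
  - unfold minus, plus, opp, cross, cx, cy, cz; simpl. ring.
Qed.

Lemma vec_derive_det3 (f g h : R -> vec3) (s : R) (df dg dh : vec3) :
  vec_derive f s df -> vec_derive g s dg -> vec_derive h s dh ->
  is_derive (fun t => det3 (f t) (g t) (h t)) s
    (det3 df (g s) (h s) + det3 (f s) dg (h s) + det3 (f s) (g s) dh).
Proof.
  intros Hf Hg Hh.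
  apply is_derive_ext with (fun t => dot (cross (f t) (g t)) (h t)).
  { intros t. now rewrite det3_cross. }
  evar_last.
  - apply (vec_derive_dot (fun t => cross (f t) (g t)) h); [ | exact Hh].
    apply vec_derive_cross; eassumption.
  - rewrite !det3_cross. unfold dot, cx, cy, cz; simpl. ring.
Qed.

Lemma smooth_on_vec_derive (I : R -> Prop) (xi : R -> vec3) (n : nat) (s : R) :
  smooth_on I xi -> I s ->
  vec_derive (Nat.iter n vderive xi) s (Nat.iter (S n) vderive xi s).
Proof.
  intros Hsm Hs.
  assert (Hit : forall m t, Derive_n (fun t => cx (xi t)) m t = cx (Nat.iter m vderive xi t)
      /\ Derive_n (fun t => cy (xi t)) m t = cy (Nat.iter m vderive xi t)
      /\ Derive_n (fun t => cz (xi t)) m t = cz (Nat.iter m vderive xi t)).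
  { induction m as [ | m IH]; [easy | intros t].
    split; [ | split]; simpl; apply Derive_ext; intros r; apply IH. }
  destruct (Hsm (S n) s Hs) as [Hx [Hy Hz]]. simpl in Hx, Hy, Hz.
  split; [ | split]; apply Derive_correct.
  - apply ex_derive_ext with (2 := Hx). intros; apply Hit.
  - apply ex_derive_ext with (2 := Hy). intros; apply Hit.
  - apply ex_derive_ext with (2 := Hz). intros; apply Hit.
Qed.

(** The last three equations come from differentiating, on the open interval, the constant products
    of [xi] with itself, of [xi] with its derivative, and of the derivative with itself. *)
Lemma spherical_curve_dots (I : R -> Prop) (xi : R -> vec3) (s : R) :
  spherical_curve I xi -> I s ->
  dot (xi s) (xi s) = 1 /\ dot (vderive xi s) (vderive xi s) = 1 /\
  dot (xi s) (vderive xi s) = 0 /\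
  dot (xi s) (vderive (vderive xi) s) = -1 /\
  dot (vderive xi s) (vderive (vderive xi) s) = 0.
Proof.
  intros [HI [Hsm Hsph]] Hs.
  assert (H0 : forall t, I t -> vec_derive xi t (vderive xi t))
    by (intros t; apply (smooth_on_vec_derive I xi 0 t Hsm)).
  assert (H1 : forall t, I t -> vec_derive (vderive xi) t (vderive (vderive xi) t))
    by (intros t; apply (smooth_on_vec_derive I xi 1 t Hsm)).
  assert (Hcomm : forall u v, dot u v = dot v u) by (intros; unfold dot; ring).
  assert (HT : forall t, I t -> dot (xi t) (vderive xi t) = 0).
  { intros t Ht.
    generalize (is_derive_const_on I (fun t => dot (xi t) (xi t)) 1 t _ HI Ht
      (fun r Hr => proj1 (Hsph r Hr)) (vec_derive_dot _ _ _ _ _ (H0 t Ht) (H0 t Ht))).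
    rewrite (Hcomm (vderive xi t)). lra. }
  destruct (Hsph s Hs) as [E1 E2].
  generalize (is_derive_const_on I (fun t => dot (vderive xi t) (vderive xi t)) 1 s _ HI Hs
      (fun r Hr => proj2 (Hsph r Hr)) (vec_derive_dot _ _ _ _ _ (H1 s Hs) (H1 s Hs))).
  generalize (is_derive_const_on I (fun t => dot (xi t) (vderive xi t)) 0 s _ HI Hs
      HT (vec_derive_dot _ _ _ _ _ (H0 s Hs) (H1 s Hs))).
  rewrite (Hcomm (vderive (vderive xi) s) (vderive xi s)).
  intros. repeat split; auto; lra.
Qed.

Definition normal (xi : R -> vec3) (s : R) : vec3 := cross (xi s) (vderive xi s).

(** The matrix with columns [x], [t], [cross x t] has orthonormal columns, hence orthonormal rows,
    and the expansion of [v] follows from the rows. *)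
Lemma frame_resolution (x t v : vec3) :
  dot x x = 1 -> dot t t = 1 -> dot x t = 0 ->
  cx v = dot v x * cx x + dot v t * cx t + dot v (cross x t) * cx (cross x t) /\
  cy v = dot v x * cy x + dot v t * cy t + dot v (cross x t) * cy (cross x t) /\
  cz v = dot v x * cz x + dot v t * cz t + dot v (cross x t) * cz (cross x t).
Proof.
  destruct x as [[x1 x2] x3], t as [[t1 t2] t3], v as [[v1 v2] v3].
  unfold dot, cross, cx, cy, cz; simpl. intros H1 H2 H3.
  (* [D] says that the first row is a unit vector and [O] that the first two rows are orthogonal;
     cyclic permutations of the indices give the other relations. *)
  assert (D : forall a b c d e f, a * a + b * b + c * c = 1 -> d * d + e * e + f * f = 1 ->
    a * d + b * e + c * f = 0 -> a * a + d * d + (b * f - c * e) * (b * f - c * e) = 1).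
  { clear. intros a b c d e f H1 H2 H3.
    replace ((b * f - c * e) * (b * f - c * e)) with
      ((b * b + c * c) * (e * e + f * f) - (b * e + c * f) * (b * e + c * f)) by ring.
    replace (b * b + c * c) with (1 - a * a) by lra.
    replace (e * e + f * f) with (1 - d * d) by lra.
    replace (b * e + c * f) with (- (a * d)) by lra. ring. }
  assert (O : forall a b c d e f, a * a + b * b + c * c = 1 -> d * d + e * e + f * f = 1 ->
    a * d + b * e + c * f = 0 ->
    a * b + d * e + (b * f - c * e) * (c * d - a * f) = 0).
  { clear. intros a b c d e f H1 H2 H3.
    replace ((b * f - c * e) * (c * d - a * f)) with
      ((c * f) * (b * d + a * e) - a * b * (f * f) - c * c * (d * e)) by ring.
    replace (c * c) with (1 - a * a - b * b) by lra.
    replace (f * f) with (1 - d * d - e * e) by lra.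
    replace (c * f) with (- (a * d) - b * e) by lra. ring. }
  assert (D1 := D x1 x2 x3 t1 t2 t3). assert (D2 := D x2 x3 x1 t2 t3 t1).
  assert (D3 := D x3 x1 x2 t3 t1 t2).
  assert (O1 := O x1 x2 x3 t1 t2 t3). assert (O2 := O x2 x3 x1 t2 t3 t1).
  assert (O3 := O x3 x1 x2 t3 t1 t2).
  specialize (D1 ltac:(lra) ltac:(lra) ltac:(lra)).
  specialize (D2 ltac:(lra) ltac:(lra) ltac:(lra)).
  specialize (D3 ltac:(lra) ltac:(lra) ltac:(lra)).
  specialize (O1 ltac:(lra) ltac:(lra) ltac:(lra)).
  specialize (O2 ltac:(lra) ltac:(lra) ltac:(lra)).
  specialize (O3 ltac:(lra) ltac:(lra) ltac:(lra)).
  set (n1 := x2 * t3 - x3 * t2) in *. set (n2 := x3 * t1 - x1 * t3) in *.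
  set (n3 := x1 * t2 - x2 * t1) in *.
  split; [ | split].
  - transitivity (v1 * (x1 * x1 + t1 * t1 + n1 * n1) + v2 * (x1 * x2 + t1 * t2 + n1 * n2)
      + v3 * (x3 * x1 + t3 * t1 + n3 * n1)); [rewrite D1, O1, O3 | ]; ring.
  - transitivity (v1 * (x1 * x2 + t1 * t2 + n1 * n2) + v2 * (x2 * x2 + t2 * t2 + n2 * n2)
      + v3 * (x2 * x3 + t2 * t3 + n2 * n3)); [rewrite O1, D2, O2 | ]; ring.
  - transitivity (v1 * (x3 * x1 + t3 * t1 + n3 * n1) + v2 * (x2 * x3 + t2 * t3 + n2 * n3)
      + v3 * (x3 * x3 + t3 * t3 + n3 * n3)); [rewrite O3, O2, D3 | ]; ring.
Qed.

(** Resolved in the frame, the second derivative of [xi] has components -1, 0 and the curvature.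
    Substituting this into the product rule for [cross (xi t) (vderive xi t)] gives the equation of
    the normal. *)
Lemma spherical_curve_frenet (I : R -> Prop) (xi : R -> vec3) :
  spherical_curve I xi ->
  frenet_row I (curvature xi) (fun t => cx (xi t)) (fun t => cx (vderive xi t))
    (fun t => cx (normal xi t)) /\
  frenet_row I (curvature xi) (fun t => cy (xi t)) (fun t => cy (vderive xi t))
    (fun t => cy (normal xi t)) /\
  frenet_row I (curvature xi) (fun t => cz (xi t)) (fun t => cz (vderive xi t))
    (fun t => cz (normal xi t)).
Proof.
  intros H.
  assert (Hall : forall s, I s -> vec_derive xi s (vderive xi s) /\
    vec_derive (vderive xi) s
      (- cx (xi s) + curvature xi s * cx (normal xi s),
       - cy (xi s) + curvature xi s * cy (normal xi s),
       - cz (xi s) + curvature xi s * cz (normal xi s)) /\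
    vec_derive (normal xi) s
      (- curvature xi s * cx (vderive xi s), - curvature xi s * cy (vderive xi s),
       - curvature xi s * cz (vderive xi s))).
  { intros s Hs. destruct (spherical_curve_dots I xi s H Hs) as [E1 [E2 [E3 [E4 E5]]]].
    destruct H as [HI [Hsm _]].
    assert (H0 : vec_derive xi s (vderive xi s)) by apply (smooth_on_vec_derive I xi 0 s Hsm Hs).
    assert (H1 : vec_derive (vderive xi) s (vderive (vderive xi) s))
      by apply (smooth_on_vec_derive I xi 1 s Hsm Hs).
    assert (H2 := vec_derive_cross _ _ _ _ _ H0 H1).
    assert (Hcomm : forall u v, dot u v = dot v u) by (intros; unfold dot; ring).
    assert (Heq : vderive (vderive xi) s = (- cx (xi s) + curvature xi s * cx (normal xi s),
       - cy (xi s) + curvature xi s * cy (normal xi s),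
       - cz (xi s) + curvature xi s * cz (normal xi s))).
    { destruct (frame_resolution (xi s) (vderive xi s) (vderive (vderive xi) s) E1 E2 E3)
        as [F1 [F2 F3]].
      rewrite !(Hcomm (vderive (vderive xi) s)), E4, E5, <- det3_cross in F1, F2, F3.
      fold (curvature xi s) in F1, F2, F3. fold (normal xi s) in F1, F2, F3.
      destruct (vderive (vderive xi) s) as [[d1 d2] d3].
      unfold cx, cy, cz in F1, F2, F3 |- *; cbn [fst snd] in F1, F2, F3 |- *.
      rewrite F1, F2, F3. f_equal; [f_equal | ]; ring. }
    split; [exact H0 | split; [rewrite <- Heq; exact H1 | ]].
    destruct H2 as [A [B C]].
    rewrite Heq in A, B, C.
    set (k := curvature xi s) in *. clearbody k.
    unfold normal in A, B, C |- *.
    destruct (xi s) as [[x1 x2] x3]. destruct (vderive xi s) as [[t1 t2] t3].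
    unfold dot, cross, cx, cy, cz in *; cbn [fst snd] in *.
    split; [ | split]; evar_last.
    - exact A.
    - transitivity (k * (x1 * (x1 * t1 + x2 * t2 + x3 * t3)
         - t1 * (x1 * x1 + x2 * x2 + x3 * x3))); [ring | rewrite E1, E3; cbn; ring].
    - exact B.
    - transitivity (k * (x2 * (x1 * t1 + x2 * t2 + x3 * t3)
         - t2 * (x1 * x1 + x2 * x2 + x3 * x3))); [ring | rewrite E1, E3; cbn; ring].
    - exact C.
    - transitivity (k * (x3 * (x1 * t1 + x2 * t2 + x3 * t3)
         - t3 * (x1 * x1 + x2 * x2 + x3 * x3))); [ring | rewrite E1, E3; cbn; ring]. }
  split; [ | split]; intros s Hs; destruct (Hall s Hs) as [A [B C]].
  - split; [apply A | split; [apply B | apply C]].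
  - split; [apply A | split; [apply B | apply C]].
  - split; [apply A | split; [apply B | apply C]].
Qed.

Lemma curvature_derive_twice (I : R -> Prop) (xi : R -> vec3) (s : R) :
  spherical_curve I xi -> I s ->
  is_derive (curvature xi) s (Derive (curvature xi) s) /\
  is_derive (Derive (curvature xi)) s (Derive_n (curvature xi) 2 s).
Proof.
  intros [HI [Hsm _]] Hs.
  assert (Hd := fun n t => smooth_on_vec_derive I xi n t Hsm).
  (* [k1] is the derivative of the curvature: the other two determinants of the product rule have a
     repeated vector. *)
  set (k1 := fun t => det3 (xi t) (vderive xi t) (vderive (vderive (vderive xi)) t)).
  assert (H1 : forall t, I t -> is_derive (curvature xi) t (k1 t)).
  { intros t Ht. evar_last.
    - apply (vec_derive_det3 xi (vderive xi) (vderive (vderive xi)) t _ _ _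
        (Hd 0%nat t Ht) (Hd 1%nat t Ht) (Hd 2%nat t Ht)).
    - unfold k1, det3; simpl. ring. }
  split.
  - apply Derive_correct. eexists. apply H1, Hs.
  - apply Derive_correct. eexists.
    apply (is_derive_loc_eq I k1); auto.
    + intros t Ht. symmetry. apply is_derive_unique, H1, Ht.
    + apply (vec_derive_det3 xi (vderive xi) (vderive (vderive (vderive xi))) s _ _ _
        (Hd 0%nat s Hs) (Hd 1%nat s Hs) (Hd 3%nat s Hs)).
Qed.

(** * Angular momentum and curvature *)

Lemma height_cz (xi : R -> vec3) (s : R) : height xi s = cz (xi s).
Proof. unfold height, dot, e_z, cx, cy, cz; simpl. ring. Qed.

Lemma Derive_height (xi : R -> vec3) (s : R) :
  Derive (height xi) s = cz (vderive xi s).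
Proof. apply Derive_ext. apply height_cz. Qed.

Lemma momentum_normal (xi : R -> vec3) (s : R) : momentum xi s = - cz (normal xi s).
Proof.
  unfold momentum, normal, cross, det3, e_z, cx, cy, cz; simpl. ring.
Qed.

Lemma frame_rows_norm (x t : vec3) :
  dot x x = 1 -> dot t t = 1 -> dot x t = 0 ->
  cx x ^ 2 + cx t ^ 2 + cx (cross x t) ^ 2 = 1 /\
  cy x ^ 2 + cy t ^ 2 + cy (cross x t) ^ 2 = 1 /\
  cz x ^ 2 + cz t ^ 2 + cz (cross x t) ^ 2 = 1.
Proof.
  intros H1 H2 H3.
  assert (E1 := proj1 (frame_resolution x t (1, 0, 0) H1 H2 H3)).
  assert (E2 := proj1 (proj2 (frame_resolution x t (0, 1, 0) H1 H2 H3))).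
  assert (E3 := proj2 (proj2 (frame_resolution x t (0, 0, 1) H1 H2 H3))).
  unfold dot, cx, cy, cz in *; simpl in *. repeat split; lra.
Qed.

Section HeightRow.

Variables (I : R -> Prop) (xi : R -> vec3).
Hypothesis Hsph : spherical_curve I xi.

Lemma height_row :
  frenet_row I (curvature xi) (height xi) (Derive (height xi)) (fun s => - momentum xi s).
Proof.
  intros s Hs. destruct (spherical_curve_frenet I xi Hsph) as [_ [_ Hz]].
  destruct (Hz s Hs) as [Hu [Hp Hn]].
  rewrite momentum_normal, Derive_height, height_cz, Ropp_involutive.
  split; [ | split].
  - eapply is_derive_ext; [ | exact Hu]. intros t. symmetry. apply height_cz.
  - eapply is_derive_ext; [ | exact Hp]. intros t. symmetry. apply Derive_height.
  - eapply is_derive_ext; [ | exact Hn]. intros t. now rewrite momentum_normal, Ropp_involutive.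
Qed.

Lemma height_row_norm (s : R) :
  I s -> height xi s ^ 2 + Derive (height xi) s ^ 2 + (- momentum xi s) ^ 2 = 1.
Proof.
  intros Hs. destruct (spherical_curve_dots I xi s Hsph Hs) as [E1 [E2 [E3 _]]].
  rewrite momentum_normal, Derive_height, height_cz, Ropp_involutive.
  apply (frame_rows_norm (xi s) (vderive xi s)); assumption.
Qed.

Lemma spherical_curve_open : Defs.open_interval I.
Proof. apply Hsph. Qed.

Lemma spherical_curve_convex : convex_pred I.
Proof. apply open_interval_convex, spherical_curve_open. Qed.

Lemma nonconstant_Derive_height :
  nonconstant_on I (height xi) -> ~ (forall s, I s -> Derive (height xi) s = 0).
Proof.
  intros [s [t [Hs [Ht Hne]]]] H. apply Hne.
  apply (constant_on_convex I); auto using spherical_curve_convex.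
  intros r Hr. rewrite <- (H r Hr). apply (height_row r Hr).
Qed.

(* Where z' vanishes, K' = k z' says nothing about k.  But h = k - 2 a z - b
   satisfies h z' = 0, and differentiating this twice along the Frenet equations
   forces (h^2)' = 0, so h <> 0 somewhere would give z' = 0 everywhere. *)
Lemma curvature_of_momentum (a b c : R) :
  nonconstant_on I (height xi) ->
  (forall s, I s -> momentum xi s = a * height xi s ^ 2 + b * height xi s + c) ->
  forall s, I s -> curvature xi s = 2 * a * height xi s + b.
Proof.
  intros Hnc Hmom.
  assert (HI := spherical_curve_open).
  set (z := height xi) in *. set (p := Derive z) in *. set (n := fun s => - momentum xi s).
  set (k := curvature xi). set (dk := Derive k).
  set (h := fun s => k s - 2 * a * z s - b).
  assert (Hrow : forall s, I s -> is_derive z s (p s) /\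
    is_derive p s (- z s + k s * n s) /\ is_derive n s (- k s * p s)) by exact height_row.
  assert (Hdk : forall s, I s -> is_derive k s (dk s)).
  { intros s Hs. apply (curvature_derive_twice I xi s Hsph Hs). }
  assert (Hdh : forall s, I s -> is_derive h s (dk s - 2 * a * p s)).
  { intros s Hs. evar_last.
    - apply (@is_derive_minus R_AbsRing R_NormedModule (fun s => k s - 2 * a * z s));
        [apply (@is_derive_minus R_AbsRing R_NormedModule k) | apply is_derive_const].
      + now apply Hdk.
      + apply is_derive_scal, (proj1 (Hrow s Hs)).
    - unfold minus, plus, opp, zero; simpl. ring. }
  (* Two expressions for the derivative of [n] are compared: [- k * p] from the Frenet system and
     [- (2 * a * z + b) * p] from the momentum. *)
  assert (Hhp : forall s, I s -> h s * p s = 0).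
  { intros s Hs. destruct (Hrow s Hs) as [Hz [_ Hn]].
    assert (Hn' : is_derive n s (- ((2 * a * z s + b) * p s))).
    { apply (is_derive_loc_eq I (fun t => - (a * z t ^ 2 + b * z t + c)) n s); auto.
      - intros t Ht. unfold n. now rewrite Hmom.
      - auto_derive.
        + repeat split; now exists (p s).
        + change (Derive (fun x => z x) s) with (p s). ring. }
    apply is_derive_unique in Hn. apply is_derive_unique in Hn'.
    rewrite Hn in Hn'. unfold h. lra. }
  assert (Hhp' : forall s, I s -> h s * (- z s + k s * n s) = 0).
  { intros s Hs.
    assert (E := is_derive_const_on I (fun t => h t * p t) 0 s _ HI Hs Hhp
      (is_derive_prod h p s _ _ (Hdh s Hs) (proj1 (proj2 (Hrow s Hs))))).
    destruct (Req_dec (h s) 0) as [-> | Hh]; [ring | ].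
    assert (Hp : p s = 0) by (destruct (Rmult_integral _ _ (Hhp s Hs)); tauto).
    rewrite Hp in E. lra. }
  assert (Hhh : forall s, I s -> h s * (dk s - 2 * a * p s) = 0).
  { intros s Hs. destruct (Req_dec (h s) 0) as [-> | Hh]; [ring | ].
    assert (Hp : p s = 0) by (destruct (Rmult_integral _ _ (Hhp s Hs)); tauto).
    assert (Hp' : - z s + k s * n s = 0) by (destruct (Rmult_integral _ _ (Hhp' s Hs)); tauto).
    assert (D : is_derive (fun t => - z t + k t * n t) s
      (- p s + (dk s * n s + k s * (- k s * p s)))).
    { apply (@is_derive_plus R_AbsRing R_NormedModule (fun t => - z t)).
      - apply (@is_derive_opp R_AbsRing R_NormedModule), (Hrow s Hs).
      - apply is_derive_prod; [now apply Hdk | apply (Hrow s Hs)]. }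
    assert (E := is_derive_const_on I (fun t => h t * (- z t + k t * n t)) 0 s _ HI Hs Hhp'
      (is_derive_prod h _ s _ _ (Hdh s Hs) D)).
    cbv beta in E. rewrite Hp', Hp in E.
    assert (Hkn : dk s * n s = 0).
    { apply (Rmult_eq_reg_l (h s)); [lra | exact Hh]. }
    assert (N := height_row_norm s Hs). fold z p in N. change (- momentum xi s) with (n s) in N.
    rewrite Hp in *.
    (* Now the norm relation reads [(k ^ 2 + 1) * n ^ 2 = 1], so [dk * n = 0] yields [dk = 0]. *)
    assert (Hz : z s = k s * n s) by lra. rewrite Hz in N.
    assert (dk s = 0); [ | rewrite H; ring].
    transitivity (dk s * ((k s * n s) ^ 2 + 0 ^ 2 + n s ^ 2)); [rewrite N; ring | ].
    transitivity (dk s * n s * (k s ^ 2 * n s + n s)); [ring | rewrite Hkn; ring]. }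
  intros s Hs. destruct (Req_dec (h s) 0) as [Hh | Hh]; [unfold h in Hh; lra | exfalso].
  apply (nonconstant_Derive_height Hnc). fold z. fold p. intros t Ht.
  assert (E : h s * h s = h t * h t).
  { apply (constant_on_convex I (fun r => h r * h r)); auto using spherical_curve_convex.
    intros r Hr. evar_last.
    - apply (is_derive_prod h h r _ _ (Hdh r Hr) (Hdh r Hr)).
    - generalize (Hhh r Hr). simpl. lra. }
  destruct (Rmult_integral _ _ (Hhp t Ht)) as [H | H]; [ | exact H].
  rewrite H in E. exfalso. apply Hh. nra.
Qed.

(** Integration of [K' = k z'], with [k] affine in [z]; the constant is read off at [s0]. *)
Lemma momentum_of_curvature (a b s0 : R) :
  I s0 -> (forall s, I s -> curvature xi s = 2 * a * height xi s + b) ->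
  exists c, forall s, I s -> momentum xi s = a * height xi s ^ 2 + b * height xi s + c.
Proof.
  intros H0 Hk.
  set (f := fun s => - momentum xi s + (a * height xi s ^ 2 + b * height xi s)).
  exists (- f s0). intros s Hs.
  assert (E : f s = f s0); [ | unfold f in *; lra].
  apply (constant_on_convex I); auto using spherical_curve_convex.
  intros r Hr. destruct (height_row r Hr) as [Hz [_ Hn]].
  evar_last.
  - apply (@is_derive_plus R_AbsRing R_NormedModule (fun s => - momentum xi s)); [exact Hn | ].
    instantiate (1 := (2 * a * height xi r + b) * Derive (height xi) r).
    auto_derive.
    + repeat split; now eexists; exact Hz.
    + change (Derive (fun x => height xi x) r) with (Derive (height xi) r). ring.
  - unfold plus; simpl. rewrite (Hk r Hr). ring.
Qed.

(** The constant [b] of the curvature and the constant [b'] of the equation are kept apart, since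
    their equality has to be derived in one direction. The residual is affine in the curvature. *)
Lemma elastic_residual (a b c b' C s : R) :
  (forall s, I s -> curvature xi s = 2 * a * height xi s + b) ->
  (forall s, I s -> momentum xi s = a * height xi s ^ 2 + b * height xi s + c) ->
  I s ->
  2 * Derive_n (curvature xi) 2 s + curvature xi s ^ 3 + (2 - 2 * C) * curvature xi s
    - 2 * b' =
  2 * (b - b') + curvature xi s * (b ^ 2 - 4 * a * c - 2 * C).
Proof.
  intros Hk Hmom Hs. assert (HI := spherical_curve_open).
  assert (D1 : forall t, I t -> Derive (curvature xi) t = 2 * a * Derive (height xi) t).
  { intros t Ht. apply is_derive_unique.
    apply (is_derive_loc_eq I (fun t => 2 * a * height xi t + b)); auto.
    - intros r Hr. symmetry. now apply Hk.
    - evar_last.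
      + apply (@is_derive_plus R_AbsRing R_NormedModule (fun t => 2 * a * height xi t));
          [apply is_derive_scal, (proj1 (height_row t Ht)) | apply is_derive_const].
      + unfold plus, zero; simpl. ring. }
  assert (D2 : Derive_n (curvature xi) 2 s
    = 2 * a * (- height xi s + curvature xi s * - momentum xi s)).
  { apply is_derive_unique.
    apply (is_derive_loc_eq I (fun t => 2 * a * Derive (height xi) t)); auto.
    - intros r Hr. symmetry. now apply D1.
    - apply is_derive_scal, (proj1 (proj2 (height_row s Hs))). }
  rewrite D2, (Hmom s Hs), (Hk s Hs). ring.
Qed.

End HeightRow.

(* The two Euler-Lagrange equations at once: b = 0, C = sigma / 2 for elasticae
   under tension sigma, and b = - lambda, C = lambda^2 / 2 for lambda-elastic curves. *)
Definition elastic_equation (I : R -> Prop) (xi : R -> vec3) (b C : R) : Prop :=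
  forall s, I s ->
    2 * Derive_n (curvature xi) 2 s + curvature xi s ^ 3 + (2 - 2 * C) * curvature xi s
      - 2 * b = 0.

(** Forward, the affine residual vanishes at two points of distinct height, hence of distinct
    curvature, so both its coefficients are zero. Backward, the momentum determines the curvature
    and the residual is zero. *)
Lemma elastic_iff_momentum (I : R -> Prop) (xi : R -> vec3) (a b C : R) :
  a <> 0 -> spherical_curve I xi -> nonconstant_on I (height xi) ->
  (elastic_equation I xi b C /\ suitable_coordinates I xi a <->
   exists c, b ^ 2 - 4 * a * c = 2 * C /\
     curve_with_momentum I xi (fun z => a * z ^ 2 + b * z + c)).
Proof.
  intros Ha Hsph Hnc. split.
  - intros [Hel [_ [b0 Hk]]].
    destruct Hnc as [s [t [Hs [Ht Hne]]]].
    destruct (momentum_of_curvature I xi Hsph a b0 s Hs Hk) as [c Hmom].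
    assert (R := fun r => elastic_residual I xi Hsph a b0 c b C r Hk Hmom).
    assert (Rs := R s Hs). assert (Rt := R t Ht).
    rewrite (Hel s Hs) in Rs. rewrite (Hel t Ht) in Rt.
    rewrite (Hk s Hs) in Rs. rewrite (Hk t Ht) in Rt.
    assert (HD : b0 ^ 2 - 4 * a * c - 2 * C = 0).
    { apply (Rmult_eq_reg_l (2 * a * (height xi s - height xi t))); [lra | ].
      repeat apply Rmult_integral_contrapositive_currified; lra. }
    rewrite HD in Rs. assert (b0 = b) by lra. subst b0.
    exists c. split; [lra | ]. split; [exact Hsph | split; [ | exact Hmom]].
    now exists s, t.
  - intros [c [HC [_ [_ Hmom]]]].
    assert (Hk := curvature_of_momentum I xi Hsph a b c Hnc Hmom).
    split; [ | split; [exact Ha | now exists b]].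
    intros s Hs. rewrite (elastic_residual I xi Hsph a b c b C s Hk Hmom Hs), <- HC. ring.
Qed.

Lemma curve_with_momentum_ext (I : R -> Prop) (xi : R -> vec3) (K K' : R -> R) :
  (forall z, K z = K' z) -> curve_with_momentum I xi K -> curve_with_momentum I xi K'.
Proof.
  intros HK [H1 [H2 H3]]. split; [exact H1 | split; [exact H2 | ]].
  intros s Hs. rewrite <- HK. now apply H3.
Qed.

Lemma unique_up_to_z_rotations_ext (K K' : R -> R) :
  (forall z, K z = K' z) -> unique_up_to_z_rotations K -> unique_up_to_z_rotations K'.
Proof.
  intros HK [H1 H2].
  assert (E : forall I xi, curve_with_momentum I xi K' -> curve_with_momentum I xi K).
  { intros I xi. now apply curve_with_momentum_ext. }
  split; intros; [apply (H1 I1 I2) | apply (H2 xi1 xi2 t1 t2)]; auto.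
Qed.

(** * Congruence of curves with equal angular momentum *)

Lemma frame_cyclic (x t : vec3) :
  dot x x = 1 -> dot t t = 1 -> dot x t = 0 ->
  cross t (cross x t) = x /\ cross (cross x t) x = t.
Proof.
  destruct x as [[x1 x2] x3], t as [[t1 t2] t3].
  unfold dot, cross, cx, cy, cz; cbn [fst snd]. intros H1 H2 H3.
  split; f_equal; [f_equal | | f_equal | ].
  - transitivity (x1 * (t1 * t1 + t2 * t2 + t3 * t3) - t1 * (x1 * t1 + x2 * t2 + x3 * t3));
      [ | rewrite H2, H3]; ring.
  - transitivity (x2 * (t1 * t1 + t2 * t2 + t3 * t3) - t2 * (x1 * t1 + x2 * t2 + x3 * t3));
      [ | rewrite H2, H3]; ring.
  - transitivity (x3 * (t1 * t1 + t2 * t2 + t3 * t3) - t3 * (x1 * t1 + x2 * t2 + x3 * t3));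
      [ | rewrite H2, H3]; ring.
  - transitivity (t1 * (x1 * x1 + x2 * x2 + x3 * x3) - x1 * (x1 * t1 + x2 * t2 + x3 * t3));
      [ | rewrite H1, H3]; ring.
  - transitivity (t2 * (x1 * x1 + x2 * x2 + x3 * x3) - x2 * (x1 * t1 + x2 * t2 + x3 * t3));
      [ | rewrite H1, H3]; ring.
  - transitivity (t3 * (x1 * x1 + x2 * x2 + x3 * x3) - x3 * (x1 * t1 + x2 * t2 + x3 * t3));
      [ | rewrite H1, H3]; ring.
Qed.

Lemma unit_angle (c s : R) : c ^ 2 + s ^ 2 = 1 -> exists theta, cos theta = c /\ sin theta = s.
Proof.
  intros H.
  assert (Hc : -1 <= c <= 1) by (generalize (pow2_ge_0 s); nra).
  assert (Hs : 1 - Rsqr c = Rsqr s) by (unfold Rsqr; lra).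
  destruct (Rle_dec 0 s) as [Hp | Hn].
  - exists (acos c). split; [now apply cos_acos | ].
    rewrite sin_acos, Hs by exact Hc. now apply sqrt_Rsqr.
  - exists (- acos c). rewrite cos_neg, sin_neg, cos_acos, sin_acos, Hs by exact Hc.
    split; [reflexivity | ]. rewrite Rsqr_neg, sqrt_Rsqr; lra.
Qed.

(** Two positively oriented orthonormal frames with the same third vector differ by a rotation about
    it: [X2] lies in the plane of [X1] and [Y1], its two components are a cosine and minus a sine,
    and [Y2] is then a cross product. *)
Lemma same_axis_angle (X1 Y1 X2 Y2 Z : vec3) :
  dot X1 X1 = 1 -> dot Y1 Y1 = 1 -> dot X1 Y1 = 0 -> dot X2 X2 = 1 -> dot X2 Z = 0 ->
  cross X1 Y1 = Z -> cross Z X2 = Y2 ->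
  exists theta,
    X2 = (cos theta * cx X1 - sin theta * cx Y1,
          cos theta * cy X1 - sin theta * cy Y1,
          cos theta * cz X1 - sin theta * cz Y1) /\
    Y2 = (sin theta * cx X1 + cos theta * cx Y1,
          sin theta * cy X1 + cos theta * cy Y1,
          sin theta * cz X1 + cos theta * cz Y1).
Proof.
  intros HX HY HXY HX2 HXZ HZ HY2.
  destruct (frame_cyclic X1 Y1 HX HY HXY) as [C1 C2].
  destruct (frame_resolution X1 Y1 X2 HX HY HXY) as [E1 [E2 E3]].
  rewrite HZ in C1, C2, E1, E2, E3. rewrite HXZ in E1, E2, E3.
  destruct (unit_angle (dot X2 X1) (- dot X2 Y1)) as [theta [Hc Hs]].
  { transitivity (dot X2 X2); [ | exact HX2].
    transitivity (cx X2 * (dot X2 X1 * cx X1 + dot X2 Y1 * cx Y1 + 0 * cx Z)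
      + cy X2 * (dot X2 X1 * cy X1 + dot X2 Y1 * cy Y1 + 0 * cy Z)
      + cz X2 * (dot X2 X1 * cz X1 + dot X2 Y1 * cz Y1 + 0 * cz Z)).
    - unfold dot. ring.
    - rewrite <- E1, <- E2, <- E3. reflexivity. }
  assert (F : X2 = (cos theta * cx X1 - sin theta * cx Y1,
          cos theta * cy X1 - sin theta * cy Y1,
          cos theta * cz X1 - sin theta * cz Y1)).
  { rewrite Hc, Hs. destruct X2 as [[a b] c].
    change (cx (a, b, c)) with a in E1. change (cy (a, b, c)) with b in E2.
    change (cz (a, b, c)) with c in E3.
    f_equal; [f_equal | ]; lra. }
  exists theta. split; [exact F | ].
  rewrite <- HY2, F. clear - C1 C2. revert C1 C2.
  destruct X1 as [[x1 x2] x3], Y1 as [[y1 y2] y3], Z as [[z1 z2] z3].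
  unfold cross, cx, cy, cz; cbn [fst snd]. intros C1 C2.
  injection C1 as A1 A2 A3. injection C2 as B1 B2 B3.
  f_equal; [f_equal | ].
  - rewrite <- A1, <- B1. ring.
  - rewrite <- A2, <- B2. ring.
  - rewrite <- A3, <- B3. ring.
Qed.

(** The transpose of a rotation matrix is a rotation matrix: the products come from resolving basis
    vectors, the cross products from those of the columns. *)
Lemma frame_rows (x t : vec3) :
  dot x x = 1 -> dot t t = 1 -> dot x t = 0 ->
  let n := cross x t in
  let X := (cx x, cx t, cx n) in
  let Y := (cy x, cy t, cy n) in
  let Z := (cz x, cz t, cz n) in
  dot X X = 1 /\ dot Y Y = 1 /\ dot X Y = 0 /\ dot X Z = 0 /\
  cross X Y = Z /\ cross Z X = Y.
Proof.
  intros H1 H2 H3 n X Y Z.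
  destruct (frame_cyclic x t H1 H2 H3) as [C1 C2]. fold n in C1, C2.
  destruct (frame_resolution x t (1, 0, 0) H1 H2 H3) as [E1 [E2 E3]].
  assert (E4 := proj1 (proj2 (frame_resolution x t (0, 1, 0) H1 H2 H3))).
  fold n in E1, E2, E3, E4.
  split; [ | split; [ | split; [ | split; [ | split]]]].
  - unfold X. unfold dot, cx, cy, cz in *; simpl in *. lra.
  - unfold Y. unfold dot, cx, cy, cz in *; simpl in *. lra.
  - unfold X, Y. unfold dot, cx, cy, cz in *; simpl in *. lra.
  - unfold X, Z. unfold dot, cx, cy, cz in *; simpl in *. lra.
  - transitivity (cz (cross t n), cz (cross n x), cz (cross x t)).
    + unfold X, Y, cross, cx, cy, cz; cbn [fst snd]. f_equal; [f_equal | ]; ring.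
    + now rewrite C1, C2.
  - transitivity (cy (cross t n), cy (cross n x), cy (cross x t)).
    + unfold X, Z, cross, cx, cy, cz; cbn [fst snd]. f_equal; [f_equal | ]; ring.
    + now rewrite C1, C2.
Qed.

Section Congruence.

Variables (a b c : R).
Hypothesis Ha : a <> 0.
Let K := fun z => a * z ^ 2 + b * z + c.

Lemma curve_with_momentum_rows (I : R -> Prop) (xi : R -> vec3) :
  curve_with_momentum I xi K ->
  convex_pred I /\
  frenet_row I (curvature xi) (height xi) (Derive (height xi)) (fun s => - momentum xi s) /\
  (forall s, I s ->
     height xi s ^ 2 + Derive (height xi) s ^ 2 + (- momentum xi s) ^ 2 = 1) /\
  (forall s, I s -> curvature xi s = 2 * a * height xi s + b).
Proof.
  intros [Hsph [Hnc Hmom]].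
  split; [now apply (spherical_curve_convex I xi) | ].
  split; [now apply height_row | ].
  split; [intros s; now apply (height_row_norm I) | ].
  now apply (curvature_of_momentum I xi Hsph a b c).
Qed.

(** Equal height rows give equal curvatures, so the remaining rows of both curves solve one linear
    system. The angle is the one relating the two frames at the matched points. *)
Lemma congruent_of_height (I1 I2 : R -> Prop) (xi1 xi2 : R -> vec3) (t1 t2 : R) :
  curve_with_momentum I1 xi1 K -> curve_with_momentum I2 xi2 K -> I1 t1 -> I2 t2 ->
  height xi1 t1 = height xi2 t2 ->
  Derive (height xi1) t1 = Derive (height xi2) t2 ->
  exists theta, forall s, I1 (t1 + s) -> I2 (t2 + s) ->
    xi2 (t2 + s) = rot_z theta (xi1 (t1 + s)).
Proof.
  intros H1 H2 Ht1 Ht2 Hz Hp.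
  destruct (curve_with_momentum_rows I1 xi1 H1) as [Cv1 [R1 [N1 K1]]].
  destruct (curve_with_momentum_rows I2 xi2 H2) as [Cv2 [R2 [N2 K2]]].
  destruct H1 as [S1 [_ M1]]. destruct H2 as [S2 [_ M2]].
  set (J := fun s => I1 (t1 + s) /\ I2 (t2 + s)).
  assert (HJ : convex_pred J).
  { intros x y z [X1 X2] [Y1 Y2] Hxz. split.
    - apply (Cv1 (t1 + x) (t1 + y)); auto; lra.
    - apply (Cv2 (t2 + x) (t2 + y)); auto; lra. }
  assert (J0 : J 0) by (unfold J; now rewrite !Rplus_0_r).
  assert (W1 : forall k u p n, frenet_row I1 k u p n -> frenet_row J (fun s => k (t1 + s))
    (fun s => u (t1 + s)) (fun s => p (t1 + s)) (fun s => n (t1 + s))).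
  { intros k u p n H s [Hs _]. now apply (frenet_row_shift I1 t1 k u p n H). }
  assert (W2 : forall k u p n, frenet_row I2 k u p n -> frenet_row J (fun s => k (t2 + s))
    (fun s => u (t2 + s)) (fun s => p (t2 + s)) (fun s => n (t2 + s))).
  { intros k u p n H s [_ Hs]. now apply (frenet_row_shift I2 t2 k u p n H). }
  assert (Hzz : forall s, J s -> height xi1 (t1 + s) = height xi2 (t2 + s)).
  { intros s Hs.
    refine (proj1 (frenet_row_affine_unique J a b 0 _ _ _ _ _ _ _ _ HJ J0
      (W1 _ _ _ _ R1) (W2 _ _ _ _ R2) _ _ _ _ _ s Hs)); rewrite ?Rplus_0_r.
    - intros r [Hr1 Hr2]. split; auto.
    - now apply N1.
    - exact Hz.
    - exact Hp.
    - now rewrite (M1 t1 Ht1), (M2 t2 Ht2), Hz. }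
  assert (Hkk : forall s, J s -> curvature xi2 (t2 + s) = curvature xi1 (t1 + s)).
  { intros s Hs. rewrite K1, K2, (Hzz s Hs) by apply Hs. reflexivity. }
  assert (W2' : forall u p n, frenet_row I2 (curvature xi2) u p n ->
    frenet_row J (fun s => curvature xi1 (t1 + s))
      (fun s => u (t2 + s)) (fun s => p (t2 + s)) (fun s => n (t2 + s))).
  { intros u p n H s Hs. rewrite <- (Hkk s Hs). now apply (W2 _ u p n H). }
  destruct (spherical_curve_dots I1 xi1 t1 S1 Ht1) as [D1 [D2 [D3 _]]].
  destruct (spherical_curve_dots I2 xi2 t2 S2 Ht2) as [E1 [E2 [E3 _]]].
  destruct (frame_rows _ _ D1 D2 D3) as [P1 [P2 [P3 [_ [P4 _]]]]].
  destruct (frame_rows _ _ E1 E2 E3) as [Q1 [_ [_ [Q3 [_ Q4]]]]].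
  fold (normal xi1 t1) in P1, P2, P3, P4. fold (normal xi2 t2) in Q1, Q3, Q4.
  (* The initial frames share their third row: height and slope agree by assumption, and the normal
     component is minus the momentum, a function of the height. *)
  assert (HZ : (cz (xi2 t2), cz (vderive xi2 t2), cz (normal xi2 t2)) =
               (cz (xi1 t1), cz (vderive xi1 t1), cz (normal xi1 t1))).
  { rewrite <- (height_cz xi1), <- (height_cz xi2), <- !Derive_height, Hz, Hp. f_equal.
    assert (L := M1 t1 Ht1). assert (L' := M2 t2 Ht2).
    rewrite momentum_normal in L, L'. rewrite Hz in L. lra. }
  rewrite HZ in Q3, Q4.
  destruct (same_axis_angle _ _ _ _ _ P1 P2 P3 Q1 Q3 P4 Q4) as [theta [T1 T2]].
  exists theta. intros s Hs1 Hs2. assert (Hs : J s) by now split.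
  destruct (spherical_curve_frenet I1 xi1 S1) as [F1 [F2 _]].
  destruct (spherical_curve_frenet I2 xi2 S2) as [G1 [G2 _]].
  assert (Zero : forall u p n : R -> R, frenet_row J (fun s => curvature xi1 (t1 + s)) u p n ->
    u 0 = 0 -> p 0 = 0 -> n 0 = 0 -> u s = 0).
  { intros u p n H A1 A2 A3.
    assert (E := frenet_row_norm J _ u p n HJ H s 0 Hs J0).
    rewrite A1, A2, A3 in E.
    generalize (pow2_ge_0 (u s)) (pow2_ge_0 (p s)) (pow2_ge_0 (n s)). nra. }
  (* The rotated first curve minus the second: a row that vanishes at 0, hence everywhere on [J]. *)
  assert (X := Zero _ _ _ (frenet_row_lin_comb J (cos theta) (- sin theta) (-1) _
    _ _ _ _ _ _ _ _ _ (W1 _ _ _ _ F1) (W1 _ _ _ _ F2) (W2' _ _ _ G1))).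
  assert (Y := Zero _ _ _ (frenet_row_lin_comb J (sin theta) (cos theta) (-1) _
    _ _ _ _ _ _ _ _ _ (W1 _ _ _ _ F1) (W1 _ _ _ _ F2) (W2' _ _ _ G2))).
  cbv beta in X, Y. rewrite !Rplus_0_r in X, Y.
  injection T1 as A1 A2 A3. injection T2 as B1 B2 B3.
  assert (X' := X ltac:(rewrite A1; unfold cx, cy, cz; simpl; ring)
    ltac:(rewrite A2; unfold cx, cy, cz; simpl; ring)
    ltac:(rewrite A3; unfold cx, cy, cz; simpl; ring)).
  assert (Y' := Y ltac:(rewrite B1; unfold cx, cy, cz; simpl; ring)
    ltac:(rewrite B2; unfold cx, cy, cz; simpl; ring)
    ltac:(rewrite B3; unfold cx, cy, cz; simpl; ring)).
  assert (Z' := Hzz s Hs). rewrite !height_cz in Z'.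
  destruct (xi2 (t2 + s)) as [[x2 y2] z2]. unfold rot_z.
  change (cx (x2, y2, z2)) with x2 in X'. change (cy (x2, y2, z2)) with y2 in Y'.
  change (cz (x2, y2, z2)) with z2 in Z'. rewrite Z'.
  f_equal. f_equal; lra.
Qed.

Lemma unique_quadratic_momentum : unique_up_to_z_rotations K.
Proof.
  split; [apply congruent_of_height | ].
  intros xi1 xi2 t1 t2 H1 H2 Hz.
  assert (Hshift : forall r1, height xi1 r1 = height xi2 t2 ->
    Derive (height xi1) r1 = Derive (height xi2) t2 ->
    exists theta tau, forall s, xi2 s = rot_z theta (xi1 (s + tau))).
  { intros r1 Hr Hr'.
    destruct (congruent_of_height _ _ xi1 xi2 r1 t2 H1 H2 Logic.I Logic.I Hr Hr') as [theta Ht].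
    exists theta, (r1 - t2). intros s. generalize (Ht (s - t2) Logic.I Logic.I).
    replace (t2 + (s - t2)) with s by ring.
    now replace (r1 + (s - t2)) with (s + (r1 - t2)) by ring. }
  destruct (curve_with_momentum_rows _ xi1 H1) as [Cv [R1 [N1 K1]]].
  destruct (curve_with_momentum_rows _ xi2 H2) as [_ [_ [N2 _]]].
  assert (M1 : forall s, - momentum xi1 s = - K (height xi1 s))
    by (intros s; now rewrite (proj2 (proj2 H1) s Logic.I)).
  assert (M2 := proj2 (proj2 H2) t2 Logic.I).
  set (p1 := Derive (height xi1)) in *. set (p2 := Derive (height xi2)) in *.
  (* Both slopes have the square [1 - z ^ 2 - K z ^ 2] at the common height. *)
  assert (Hsq : (p1 t1 - p2 t2) * (p1 t1 + p2 t2) = 0).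
  { generalize (N1 t1 Logic.I) (N2 t2 Logic.I). rewrite M1, M2, Hz. intros. nra. }
  destruct (Rmult_integral _ _ Hsq) as [Hp | Hp].
  - apply (Hshift t1); [exact Hz | lra].
  (* Opposite slopes: the height row of [xi1] agrees with its reflection about the turning point
     [m], as the slope vanishes there. So at [2 * m - t1] the height is that of [t1] and the slope
     is reversed, and this point can be matched with [t2]. *)
  - destruct (frenet_row_turning_point a b c _ _ _ _ Ha R1 (fun s => N1 s Logic.I)
      (fun s => K1 s Logic.I) M1) as [m Hm].
    assert (Hmm : 2 * m - m = m) by ring.
    destruct (frenet_row_affine_unique (fun _ => True) a b m _ _ _ _ _ _ _ _ Cv Logic.I
      R1 (frenet_row_reflect (fun _ => True) (2 * m) _ _ _ _ R1)) with (s := 2 * m - t1)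
      as [Hu Hu']; rewrite ?Hmm; try reflexivity; try exact Logic.I.
    + intros s _. split; apply K1; exact Logic.I.
    + now apply N1.
    + rewrite Hm. ring.
    + replace (2 * m - (2 * m - t1)) with t1 in Hu, Hu' by ring.
      apply (Hshift (2 * m - t1)); [ | fold p1]; lra.
Qed.

End Congruence.

(** * Coordinates adapted to an elastic curve *)

(** One coordinate of the conserved vector [V]. In the derivative the terms in [k' u] and [k k' n]
    cancel; the rest is [p / 2] times the left side of the elastic equation. *)
Lemma elastic_vector_derive (I : R -> Prop) (xi : R -> vec3) (b C : R) (u p n : R -> R) :
  spherical_curve I xi -> elastic_equation I xi b C ->
  frenet_row I (curvature xi) u p n ->
  forall s, I s -> is_derive (fun t => (curvature xi t - b) * u t
    + Derive (curvature xi) t * p t + (C - curvature xi t ^ 2 / 2) * n t) s 0.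
Proof.
  intros Hsph Hel Hrow s Hs.
  destruct (curvature_derive_twice I xi s Hsph Hs) as [D1 D2].
  destruct (Hrow s Hs) as [Hu [Hp Hn]]. assert (Eq := Hel s Hs).
  set (k := curvature xi) in *. set (dk := Derive k) in *.
  set (ddk := Derive_n k 2 s) in *. clearbody ddk.
  assert (D0 : is_derive (fun t => k t - b) s (dk s)).
  { evar_last.
    - apply (@is_derive_minus R_AbsRing R_NormedModule k); [exact D1 | apply is_derive_const].
    - unfold minus, plus, opp, zero; simpl. ring. }
  assert (D3 : is_derive (fun t => C - k t ^ 2 / 2) s (- (k s * dk s))).
  { auto_derive.
    - repeat split. now exists (dk s).
    - change (Derive (fun x => k x) s) with (dk s). field. }
  evar_last.
  - apply (@is_derive_plus R_AbsRing R_NormedModule (fun t => (k t - b) * u t + dk t * p t));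
      [apply (@is_derive_plus R_AbsRing R_NormedModule (fun t => (k t - b) * u t)) | ];
      apply is_derive_prod; eassumption.
  - unfold plus; cbn -[pow].
    transitivity (p s / 2 * (2 * ddk + k s ^ 3 + (2 - 2 * C) * k s - 2 * b));
      [field | rewrite Eq; apply Rmult_0_r].
Qed.

Lemma orthonormal_completion (w : vec3) :
  dot w w = 1 -> exists u v, dot u u = 1 /\ dot v v = 1 /\ dot u v = 0 /\ cross u v = w.
Proof.
  destruct w as [[x y] z]. intros H. unfold dot, cx, cy, cz in H; simpl in H.
  destruct (Req_dec (1 + z) 0) as [Hz | Hz].
  - assert (z = -1) by lra. subst z. assert (x = 0) by nra. assert (y = 0) by nra. subst.
    exists (1, 0, 0), (0, -1, 0). unfold dot, cross, cx, cy, cz; simpl.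
    repeat split; try ring. f_equal; [f_equal | ]; ring.
  (* The images of the first two basis vectors under the rotation that carries [e_z] to [w] along a
     great circle, which degenerates only at the south pole. *)
  - exists (1 - x * x / (1 + z), - (x * y) / (1 + z), - x),
      (- (x * y) / (1 + z), 1 - y * y / (1 + z), - y).
    unfold dot, cross, cx, cy, cz; simpl.
    split; [ | split; [ | split]].
    + transitivity (1 + x * x * (x * x + y * y + z * z - 1) / ((1 + z) * (1 + z)));
        [now field | rewrite H; now field].
    + transitivity (1 + y * y * (x * x + y * y + z * z - 1) / ((1 + z) * (1 + z)));
        [now field | rewrite H; now field].
    + transitivity (x * y * (x * x + y * y + z * z - 1) / ((1 + z) * (1 + z)));
        [now field | rewrite H; now field].
    + f_equal; [f_equal | ].
      * now field.
      * now field.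
      * transitivity (z - (x * x + y * y + z * z - 1) / (1 + z));
          [now field | rewrite H; now field].
Qed.

(** Since [rotate] acts on curves, the rotation of a single vector is written with a constant
    curve. *)
Lemma vec_derive_rotate (A : vec3 * vec3 * vec3) (f : R -> vec3) (s : R) (df : vec3) :
  vec_derive f s df -> vec_derive (rotate A f) s (rotate A (fun _ => df) s).
Proof.
  destruct A as [[u v] w]. intros H.
  assert (L : forall a : vec3, is_derive (fun t => dot a (f t)) s (dot a df)).
  { intros a. evar_last.
    - apply (vec_derive_dot (fun _ => a) f s (0, 0, 0) df); [ | exact H].
      split; [ | split]; apply (@is_derive_const R_AbsRing R_NormedModule).
    - unfold dot, cx, cy, cz; simpl. ring. }
  split; [ | split]; apply L.
Qed.

(** The sum rule for higher derivatives asks for differentiability in a neighbourhood, which the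
    openness of [I] supplies. *)
Lemma ex_derive_n_lin_comb (I : R -> Prop) (a b c : R) (f g h : R -> R) (n : nat) (s : R) :
  Defs.open_interval I -> I s ->
  (forall m t, I t -> ex_derive_n f m t /\ ex_derive_n g m t /\ ex_derive_n h m t) ->
  ex_derive_n (fun t => a * f t + b * g t + c * h t) n s.
Proof.
  intros HI Hs H.
  assert (Hloc : locally s I) by now apply open_interval_locally.
  apply (ex_derive_n_plus (fun t => a * f t + b * g t));
    [ revert Hloc; apply filter_imp; intros t Ht m _ .. ].
  - apply (ex_derive_n_plus (fun t => a * f t));
      generalize (open_interval_locally I t HI Ht); apply filter_imp;
      intros r Hr j _; apply ex_derive_n_scal_l, H, Hr.
  - apply ex_derive_n_scal_l, H, Ht.
Qed.

Section Rotation.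

Variables (u v : vec3).
Hypothesis Hu : dot u u = 1.
Hypothesis Hv : dot v v = 1.
Hypothesis Huv : dot u v = 0.
Let A := (u, v, cross u v).

Lemma rotation_orthonormal : rotation A.
Proof.
  assert (E : dot (cross u v) (cross u v) = dot u u * dot v v - dot u v ^ 2)
    by (unfold dot, cross, cx, cy, cz; simpl; ring).
  unfold A, rotation. rewrite det3_cross, E, Hu, Hv, Huv.
  repeat split; try ring; unfold dot, cross, cx, cy, cz; simpl; ring.
Qed.

(** Parseval's identity for the orthonormal rows of [A]. *)
Lemma dot_rotate (p q : vec3) :
  dot (rotate A (fun _ => p) 0) (rotate A (fun _ => q) 0) = dot p q.
Proof.
  destruct (frame_resolution u v p Hu Hv Huv) as [E1 [E2 E3]].
  symmetry. unfold dot at 1. rewrite E1, E2, E3. unfold A, rotate.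
  generalize (cross u v). intros w. unfold dot, cx, cy, cz; simpl. ring.
Qed.

Lemma det3_rotate (p q r : vec3) :
  det3 (rotate A (fun _ => p) 0) (rotate A (fun _ => q) 0) (rotate A (fun _ => r) 0)
  = det3 p q r.
Proof.
  transitivity (det3 u v (cross u v) * det3 p q r).
  - unfold A, rotate. generalize (cross u v). intros w.
    unfold det3, dot, cx, cy, cz; simpl. ring.
  - assert (E : det3 u v (cross u v) = 1) by apply rotation_orthonormal.
    rewrite E. ring.
Qed.

Variables (I : R -> Prop) (xi : R -> vec3).
Hypothesis Hsph : spherical_curve I xi.

(** The first-order identity holds on the whole open interval and can therefore be differentiated
    once more. *)
Lemma vderive_rotate (s : R) :
  I s -> vderive (rotate A xi) s = rotate A (vderive xi) s /\
    vderive (vderive (rotate A xi)) s = rotate A (vderive (vderive xi)) s.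
Proof.
  destruct Hsph as [HI [Hsm _]].
  assert (E : forall t, I t -> vderive (rotate A xi) t = rotate A (vderive xi) t).
  { intros t Ht. apply vec_derive_unique.
    apply (vec_derive_rotate A xi t (vderive xi t)), (smooth_on_vec_derive I xi 0 t Hsm Ht). }
  intros Hs. split; [now apply E | ].
  apply vec_derive_unique.
  assert (V := vec_derive_rotate A (vderive xi) s _ (smooth_on_vec_derive I xi 1 s Hsm Hs)).
  destruct V as [Vx [Vy Vz]].
  split; [ | split].
  - apply (is_derive_loc_eq I _ _ _ _ HI Hs) with (2 := Vx).
    intros t Ht. now rewrite E.
  - apply (is_derive_loc_eq I _ _ _ _ HI Hs) with (2 := Vy).
    intros t Ht. now rewrite E.
  - apply (is_derive_loc_eq I _ _ _ _ HI Hs) with (2 := Vz).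
    intros t Ht. now rewrite E.
Qed.

Lemma spherical_curve_rotate : spherical_curve I (rotate A xi).
Proof.
  split; [apply Hsph | split].
  - intros n s Hs. destruct Hsph as [HI [Hsm _]].
    split; [ | split]; now apply (ex_derive_n_lin_comb I).
  - intros s Hs. rewrite (proj1 (vderive_rotate s Hs)).
    destruct (proj2 (proj2 Hsph) s Hs) as [E1 E2].
    split; [rewrite <- E1 | rewrite <- E2]; apply dot_rotate.
Qed.

Lemma curvature_rotate (s : R) : I s -> curvature (rotate A xi) s = curvature xi s.
Proof.
  intros Hs. unfold curvature. destruct (vderive_rotate s Hs) as [-> ->].
  apply det3_rotate.
Qed.

End Rotation.

(** The new z-axis is the direction of the constant vector [V]. As the product of [V] with [xi] is
    [k - b], the curvature becomes the length of [V] times the new height, plus [b]. *)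
Lemma elastic_suitable_coordinates (I : R -> Prop) (xi : R -> vec3) (b C : R) :
  spherical_curve I xi -> elastic_equation I xi b C -> nonconstant_on I (curvature xi) ->
  exists A a, rotation A /\ suitable_coordinates I (rotate A xi) a /\
    spherical_curve I (rotate A xi) /\ nonconstant_on I (height (rotate A xi)) /\
    elastic_equation I (rotate A xi) b C.
Proof.
  intros Hsph Hel Hnc.
  destruct (spherical_curve_frenet I xi Hsph) as [Fx [Fy Fz]].
  assert (HI := proj1 Hsph). assert (Hcv := open_interval_convex I HI).
  set (k := curvature xi) in *.
  set (V := fun s => ((k s - b) * cx (xi s) + Derive k s * cx (vderive xi s)
      + (C - k s ^ 2 / 2) * cx (normal xi s),
     (k s - b) * cy (xi s) + Derive k s * cy (vderive xi s)
      + (C - k s ^ 2 / 2) * cy (normal xi s),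
     (k s - b) * cz (xi s) + Derive k s * cz (vderive xi s)
      + (C - k s ^ 2 / 2) * cz (normal xi s))).
  destruct Hnc as [s [t [Hs [Ht Hne]]]].
  assert (HV : forall r, I r -> V r = V s).
  { intros r Hr.
    assert (L := fun u p n H => constant_on_convex I _ Hcv
      (elastic_vector_derive I xi b C u p n Hsph Hel H) r s Hr Hs).
    unfold V. f_equal; [f_equal | ];
      [apply (L _ _ _ Fx) | apply (L _ _ _ Fy) | apply (L _ _ _ Fz)]. }
  assert (Hk : forall r, I r -> dot (V s) (xi r) = k r - b).
  { intros r Hr. rewrite <- (HV r Hr).
    destruct (spherical_curve_dots I xi r Hsph Hr) as [E1 [_ [E3 _]]].
    transitivity ((k r - b) * dot (xi r) (xi r) + Derive k r * dot (xi r) (vderive xi r)).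
    - unfold V, normal, dot, cross, cx, cy, cz; simpl. ring.
    - rewrite E1, E3. ring. }
  set (q := dot (V s) (V s)).
  (* If [V] were zero, the curvature would be constantly [b]. *)
  assert (Hq : 0 < q).
  { apply Rnot_le_lt. intros Hq.
    assert (Z : cx (V s) = 0 /\ cy (V s) = 0 /\ cz (V s) = 0).
    { unfold q, dot in Hq. repeat split; nra. }
    destruct Z as [Z1 [Z2 Z3]]. apply Hne.
    assert (G1 := Hk s Hs). assert (G2 := Hk t Ht).
    unfold dot in G1, G2. rewrite Z1, Z2, Z3 in G1, G2. lra. }
  assert (Hl := sqrt_lt_R0 q Hq). assert (Hl2 := sqrt_sqrt q (Rlt_le _ _ Hq)).
  set (l := sqrt q) in *.
  set (w := (cx (V s) / l, cy (V s) / l, cz (V s) / l)).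
  destruct (orthonormal_completion w) as [u [v [Hu [Hv [Huv Hw]]]]].
  { transitivity (q / (l * l)).
    - unfold w, q, dot, cx, cy, cz; simpl. field. lra.
    - rewrite Hl2. field. lra. }
  set (A := (u, v, cross u v)).
  assert (Hh : forall r, I r -> k r = 2 * (l / 2) * height (rotate A xi) r + b).
  { intros r Hr. rewrite height_cz. change (cz (rotate A xi r)) with (dot (cross u v) (xi r)).
    rewrite Hw. transitivity (dot (V s) (xi r) + b); [rewrite Hk by exact Hr; ring | ].
    unfold w, dot, cx, cy, cz; simpl. field. lra. }
  assert (Hcurv := curvature_rotate u v Hu Hv Huv I xi Hsph). fold A k in Hcurv.
  (* Half the length of [V], because suitable coordinates ask for the slope [2 * a]. *)
  exists A, (l / 2).
  split; [now apply rotation_orthonormal | ].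
  split.
  { split; [lra | ]. exists b. intros r Hr. rewrite Hcurv by exact Hr. now apply Hh. }
  split; [now apply spherical_curve_rotate | ].
  split.
  { exists s, t. split; [exact Hs | split; [exact Ht | ]]. intros E. apply Hne.
    rewrite (Hh s Hs), (Hh t Ht), E. reflexivity. }
  intros r Hr. rewrite <- (Hel r Hr), Hcurv by exact Hr. fold k.
  rewrite (Derive_n_ext_loc (curvature (rotate A xi)) k 2 r); [reflexivity | ].
  generalize (open_interval_locally I r HI Hr). apply filter_imp. exact Hcurv.
Qed.

(** * Specialization to elasticae under tension, free elasticae and lambda-elastic curves *)

Lemma elastica_equation (I : R -> Prop) (xi : R -> vec3) (sigma : R) :
  elastica I xi sigma <-> elastic_equation I xi 0 (sigma / 2).
Proof.
  split; intros H s Hs; (etransitivity; [ | exact (H s Hs)]); field.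
Qed.

Lemma lambda_elastic_equation (I : R -> Prop) (xi : R -> vec3) (lambda : R) :
  lambda_elastic I xi lambda <-> elastic_equation I xi (- lambda) (lambda ^ 2 / 2).
Proof.
  split; intros H s Hs; (etransitivity; [ | exact (H s Hs)]); field.
Qed.

Lemma elastica_iff_momentum (sigma a : R) (I : R -> Prop) (xi : R -> vec3) :
  a <> 0 -> spherical_curve I xi -> nonconstant_on I (height xi) ->
  (elastica I xi sigma /\ suitable_coordinates I xi a <->
   exists c, sigma = - 4 * a * c /\ curve_with_momentum I xi (fun z => a * z ^ 2 + c)).
Proof.
  intros Ha Hsph Hnc.
  rewrite elastica_equation, (elastic_iff_momentum I xi a 0 (sigma / 2) Ha Hsph Hnc).
  split; intros [c [Hc Hm]]; exists c; (split; [lra | ]);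
    apply curve_with_momentum_ext with (2 := Hm); intros z; ring.
Qed.

Lemma free_elastica_iff_momentum (a : R) (I : R -> Prop) (xi : R -> vec3) :
  a <> 0 -> spherical_curve I xi -> nonconstant_on I (height xi) ->
  (free_elastica I xi /\ suitable_coordinates I xi a <->
   curve_with_momentum I xi (fun z => a * z ^ 2)).
Proof.
  intros Ha Hsph Hnc. unfold free_elastica.
  rewrite (elastica_iff_momentum 0 a I xi Ha Hsph Hnc). split.
  - intros [c [Hc Hm]].
    assert (c = 0) by (apply (Rmult_eq_reg_l (- 4 * a)); lra). subst c.
    apply curve_with_momentum_ext with (2 := Hm). intros z; ring.
  - intros Hm. exists 0. split; [ring | ].
    apply curve_with_momentum_ext with (2 := Hm). intros z; ring.
Qed.

Lemma lambda_elastic_iff_momentum (lambda a : R) (I : R -> Prop) (xi : R -> vec3) :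
  a <> 0 -> spherical_curve I xi -> nonconstant_on I (height xi) ->
  (lambda_elastic I xi lambda /\ suitable_coordinates I xi a <->
   exists b, lambda = - b /\ curve_with_momentum I xi (fun z => a * z ^ 2 + b * z)).
Proof.
  intros Ha Hsph Hnc.
  rewrite lambda_elastic_equation,
    (elastic_iff_momentum I xi a (- lambda) (lambda ^ 2 / 2) Ha Hsph Hnc). split.
  - intros [c [Hc Hm]]. exists (- lambda). split; [ring | ].
    (* Here [b ^ 2] and [2 * C] both equal [lambda ^ 2], so the relation [b ^ 2 - 4 * a * c = 2 * C]
       leaves [a * c = 0]. *)
    assert (c = 0) by (apply (Rmult_eq_reg_l (- 4 * a)); lra). subst c.
    apply curve_with_momentum_ext with (2 := Hm). intros z; ring.
  - intros [b [-> Hm]]. exists 0. split; [field | ].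
    apply curve_with_momentum_ext with (2 := Hm). intros z; ring.
Qed.

Theorem corollary3p3 :
  (* (a) elasticae under tension sigma: K(z) = a z^2 + c, sigma = -4ac *)
  ((forall (sigma : R) (I : R -> Prop) (xi : R -> vec3),
      spherical_curve I xi -> elastica I xi sigma ->
      nonconstant_on I (curvature xi) ->
      exists A a c, rotation A /\ suitable_coordinates I (rotate A xi) a /\
        sigma = - 4 * a * c /\
        curve_with_momentum I (rotate A xi) (fun z => a * z ^ 2 + c)) /\
   (forall (sigma a : R) (I : R -> Prop) (xi : R -> vec3),
      a <> 0 -> spherical_curve I xi -> nonconstant_on I (height xi) ->
      (elastica I xi sigma /\ suitable_coordinates I xi a <->
       exists c, sigma = - 4 * a * c /\
         curve_with_momentum I xi (fun z => a * z ^ 2 + c))) /\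
   (forall a c : R, a <> 0 ->
      unique_up_to_z_rotations (fun z => a * z ^ 2 + c)))
  /\
  (* (a), in particular: free elasticae, K(z) = a z^2 *)
  ((forall (I : R -> Prop) (xi : R -> vec3),
      spherical_curve I xi -> free_elastica I xi ->
      nonconstant_on I (curvature xi) ->
      exists A a, rotation A /\ suitable_coordinates I (rotate A xi) a /\
        curve_with_momentum I (rotate A xi) (fun z => a * z ^ 2)) /\
   (forall (a : R) (I : R -> Prop) (xi : R -> vec3),
      a <> 0 -> spherical_curve I xi -> nonconstant_on I (height xi) ->
      (free_elastica I xi /\ suitable_coordinates I xi a <->
       curve_with_momentum I xi (fun z => a * z ^ 2))) /\
   (forall a : R, a <> 0 ->
      unique_up_to_z_rotations (fun z => a * z ^ 2)))
  /\
  (* (b) lambda-elastic curves: K(z) = a z^2 + b z, lambda = -b *)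
  ((forall (lambda : R) (I : R -> Prop) (xi : R -> vec3),
      spherical_curve I xi -> lambda_elastic I xi lambda ->
      nonconstant_on I (curvature xi) ->
      exists A a b, rotation A /\ suitable_coordinates I (rotate A xi) a /\
        lambda = - b /\
        curve_with_momentum I (rotate A xi) (fun z => a * z ^ 2 + b * z)) /\
   (forall (lambda a : R) (I : R -> Prop) (xi : R -> vec3),
      a <> 0 -> spherical_curve I xi -> nonconstant_on I (height xi) ->
      (lambda_elastic I xi lambda /\ suitable_coordinates I xi a <->
       exists b, lambda = - b /\
         curve_with_momentum I xi (fun z => a * z ^ 2 + b * z))) /\
   (forall a b : R, a <> 0 ->
      unique_up_to_z_rotations (fun z => a * z ^ 2 + b * z))).
Proof.
  split; [ | split].
  - split; [ | split].
    + intros sigma I xi Hsph Hel Hnc.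
      destruct (elastic_suitable_coordinates I xi 0 (sigma / 2))
        as [A [a [HA [Hsuit [Hsph' [Hnc' Hel']]]]]]; auto.
      { now apply elastica_equation. }
      apply elastica_equation in Hel'.
      destruct (proj1 (elastica_iff_momentum sigma a I _ (proj1 Hsuit) Hsph' Hnc')) as [c Hc];
        [now split | ].
      exists A, a, c. tauto.
    + exact elastica_iff_momentum.
    + intros a c Ha. apply unique_up_to_z_rotations_ext with (fun z => a * z ^ 2 + 0 * z + c).
      * intros z. ring.
      * now apply unique_quadratic_momentum.
  - split; [ | split].
    + intros I xi Hsph Hel Hnc.
      destruct (elastic_suitable_coordinates I xi 0 (0 / 2))
        as [A [a [HA [Hsuit [Hsph' [Hnc' Hel']]]]]]; auto.
      { now apply elastica_equation. }
      apply elastica_equation in Hel'.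
      exists A, a. split; [exact HA | split; [exact Hsuit | ]].
      apply (free_elastica_iff_momentum a I _ (proj1 Hsuit) Hsph' Hnc'). now split.
    + exact free_elastica_iff_momentum.
    + intros a Ha. apply unique_up_to_z_rotations_ext with (fun z => a * z ^ 2 + 0 * z + 0).
      * intros z. ring.
      * now apply unique_quadratic_momentum.
  - split; [ | split].
    + intros lambda I xi Hsph Hel Hnc.
      destruct (elastic_suitable_coordinates I xi (- lambda) (lambda ^ 2 / 2))
        as [A [a [HA [Hsuit [Hsph' [Hnc' Hel']]]]]]; auto.
      { now apply lambda_elastic_equation. }
      apply lambda_elastic_equation in Hel'.
      destruct (proj1 (lambda_elastic_iff_momentum lambda a I _ (proj1 Hsuit) Hsph' Hnc'))
        as [b Hb]; [now split | ].
      exists A, a, b. tauto.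
    + exact lambda_elastic_iff_momentum.
    + intros a b Ha. apply unique_up_to_z_rotations_ext with (fun z => a * z ^ 2 + b * z + 0).
      * intros z. ring.
      * now apply unique_quadratic_momentum.
Qed.
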